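(* Let $L,a,b,c>0$ be constants and let $p\in L^1[0,L]$ satisfy $$\frac{2a^2M^2}{bL^2N}>\|p\|_1 .$$ Consider the boundary value problem $$w''''(x)-\Big(a+b\int_0^Lw(t)\,dt\Big)w''(x)+c\int_0^Lw(t)\,dt=p(x),\quad x\in(0,L),\qquad w(0)=w(L)=w''(0)=w''(L)=0,$$ and let $\varphi$ be the unique fixed point of the operator $A$ in the closed ball $B[0,2\|p\|_1]$ and $w=S\varphi$ the corresponding solution (see context). Let $\varphi_0\in B[0,2\|p\|_1]$ be arbitrary and set $\varphi_{m+1}=A\varphi_m$ and $w_m=S\varphi_m$ for $m=0,1,2,\dots$. Put $$q=\|p\|_1\,\frac{bL^2N}{2a^2M^2}<1,\qquad K=\frac{2M-1}{M}\,\frac{L^2}{8a}.$$ Then $w_m$ converges to $w$ in $L^1[0,L]$, and for every $m\ge0$ $$\|w_m-w\|_1\le K\|\varphi_m-\varphi\|_1\le\frac{K}{1-q}\|\varphi_{m+1}-\varphi_m\|_1\le\frac{qK}{1-q}\|\varphi_m-\varphi_{m-1}\|_1\le\cdots\le\frac{q^{m-1}K}{1-q}\|\varphi_2-\varphi_1\|_1\le\frac{q^mK}{1-q}\|\varphi_1-\varphi_0\|_1,$$ where the chain after the second inequality runs through the quantities $\frac{q^{m-j}K}{1-q}\|\varphi_{j+1}-\varphi_j\|_1$ for $j=m,m-1,\dots,1,0$, in this order. If, in addition, $p\ge0$, then the limit $w$ is the unique solution in $W^{4,1}[0,L]$ of the boundary value problem with nonnegative integral over $[0,L]$.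
   Context: $\|\cdot\|_1$ is the norm of $L^1[0,L]$, and $B[0,2\|p\|_1]=\{\varphi\in L^1[0,L]:\|\varphi\|_1\le2\|p\|_1\}$. Differential equations (and $p\ge0$) are understood almost everywhere; solutions are functions in $W^{4,1}[0,L]$. Notation: $$M=1+c\Big(\frac{L^3}{12a}-\frac{L}{a^2}+\frac{2}{a^{5/2}}\tanh\frac{\sqrt aL}{2}\Big),\qquad N=1+c\Big(\frac{5L^3}{24a}-\frac{L}{a^2}+\frac{1}{a^{5/2}}\big(2-\tfrac{aL^2}{4}\big)\tanh\frac{\sqrt aL}{2}\Big).$$ Let $G:[0,L]^2\to\mathbb R$ be the Green function of $w\mapsto w''''-aw''$ with boundary conditions $w(0)=w(L)=w''(0)=w''(L)=0$, i.e. $G(x,s)=\frac{x(L-s)}{aL}-\frac{\sinh(\sqrt a x)\sinh(\sqrt a(L-s))}{a\sqrt a\sinh(\sqrt aL)}$ for $0\le x\le s\le L$, and $G(x,s)=G(s,x)$ for $s\le x$. For $\varphi\in L^1[0,L]$, the linear problem $w''''-aw''+c\int_0^Lw(t)\,dt=\varphi$ on $(0,L)$, $w(0)=w(L)=w''(0)=w''(L)=0$, has a unique solution $w=S\varphi\in W^{4,1}[0,L]$, given by $$(S\varphi)(x)=\int_0^LG(x,s)\varphi(s)\,ds-\frac{c\int_0^LG(x,s)\,ds}{1+c\int_0^L\int_0^LG(t,s)\,ds\,dt}\int_0^L\int_0^LG(t,s)\varphi(s)\,ds\,dt .$$ The operator $A:L^1[0,L]\to L^1[0,L]$ is defined by $$(A\varphi)(x)=p(x)+b\Big(\int_0^Lw(t)\,dt\Big)w''(x),\qquad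 w=S\varphi .$$ Under the stated norm condition on $p$, $A$ has a unique fixed point $\varphi$ in $B[0,2\|p\|_1]$, and $w=S\varphi$ is then a solution of the boundary value problem. *)

(* Defs.v *)
From HB Require Import structures.
From mathcomp Require Import all_boot all_order all_algebra.
From mathcomp Require Import all_classical all_reals all_analysis.

Set Implicit Arguments.
Unset Strict Implicit.
Unset Printing Implicit Defensive.

Import Order.TTheory GRing.Theory Num.Theory.
Import numFieldNormedType.Exports.

Local Open Scope classical_set_scope.
Local Open Scope ring_scope.

Definition sinh {R : realType} (x : R) : R := (expR x - expR (- x)) / 2.

Definition tanh {R : realType} (x : R) : R :=
  (expR x - expR (- x)) / (expR x + expR (- x)).

(** * The space L^1[0,L]

   Elements of L^1[0,L] are represented by functions R -> R integrable on
   [0,L]; only their values on [0,L] matter, and equality of classes is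
   [eqL1]. *)

Definition inL1 {R : realType} (L : R) (f : R -> R) : Prop :=
  (@lebesgue_measure R).-integrable `[0, L] (EFin \o f).

Definition normL1 {R : realType} (L : R) (f : R -> R) : R :=
  \int[@lebesgue_measure R]_(x in `[0, L]) `|f x|.

Definition eqL1 {R : realType} (L : R) (f g : R -> R) : Prop :=
  {ae @lebesgue_measure R, forall x, x \in `[0, L] -> f x = g x}.

Definition in_ballL1 {R : realType} (L r : R) (f : R -> R) : Prop :=
  inL1 L f /\ normL1 L f <= r.

(* [normL1] is only meaningful on L^1[0,L], hence the membership conditions. *)
Definition cvgL1 {R : realType} (L : R) (u : nat -> R -> R) (v : R -> R)
    : Prop :=
  [/\ forall m, inL1 L (u m), inL1 L v &
      (fun m => normL1 L (fun x => u m x - v x)) @ \oo --> (0 : R)].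

(** * Sobolev spaces W^{k,1}[0,L] *)

(* Absolute continuity on [0,L]; the finitely many non-overlapping intervals
   ]s i, t i[ are listed from left to right. *)
Definition abs_continuous {R : realType} (L : R) (f : R -> R) : Prop :=
  forall e : R, 0 < e -> exists2 d : R, 0 < d &
    forall (n : nat) (s t : 'I_n -> R),
      (forall i, [/\ 0 <= s i, s i <= t i & t i <= L]) ->
      (forall i j : 'I_n, (i < j)%N -> t i <= s j) ->
      \sum_(i < n) (t i - s i) < d ->
      \sum_(i < n) `|f (t i) - f (s i)| < e.

(* f, through its absolutely continuous representative, is in W^{1,1}[0,L]
   with derivative g. *)
Definition W11_deriv {R : realType} (L : R) (f g : R -> R) : Prop :=
  [/\ abs_continuous L f, inL1 L g &
      {ae @lebesgue_measure R, forall x : R,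
         x \in `]0, L[ -> is_derive x (1 : R) f (g x)}].

(* w is in W^{4,1}[0,L] with successive derivatives w1, w2, w3, w4.  As w1,
   w2, w3 are absolutely continuous, their values at 0 and L are determined
   by w. *)
Definition W41_derivs {R : realType} (L : R) (w w1 w2 w3 w4 : R -> R) : Prop :=
  [/\ W11_deriv L w w1, W11_deriv L w1 w2, W11_deriv L w2 w3
    & W11_deriv L w3 w4].

(** * The boundary value problem *)

Definition bvp_solution {R : realType} (L a b c : R) (p w : R -> R) : Prop :=
  let I := \int[@lebesgue_measure R]_(t in `[0, L]) w t in
  exists w1 w2 w3 w4 : R -> R,
    [/\ W41_derivs L w w1 w2 w3 w4,
        eqL1 L (fun x => w4 x - (a + b * I) * w2 x + c * I) p,
        w 0 = 0 /\ w L = 0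
      & w2 0 = 0 /\ w2 L = 0].

(** * The operators S and A *)

Definition greenG {R : realType} (L a : R) (x s : R) : R :=
  let g (x s : R) :=
    x * (L - s) / (a * L)
    - sinh (Num.sqrt a * x) * sinh (Num.sqrt a * (L - s))
      / (a * Num.sqrt a * sinh (Num.sqrt a * L)) in
  if x <= s then g x s else g s x.

Definition opS {R : realType} (L a c : R) (phi : R -> R) (x : R) : R :=
  let mu := @lebesgue_measure R in
  let G := greenG L a in
  let Gphi (t : R) := \int[mu]_(s in `[0, L]) (G t s * phi s) in
  let G1 (t : R) := \int[mu]_(s in `[0, L]) (G t s) in
  Gphi x
  - (c * G1 x) / (1 + c * (\int[mu]_(t in `[0, L]) (G1 t)))
    * (\int[mu]_(t in `[0, L]) (Gphi t)).

(* The second derivative of S phi is the classical one, which is meaningful on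
   ]0,L[, that is, almost everywhere on [0,L]. *)
Definition opA {R : realType} (L a b c : R) (p phi : R -> R) (x : R) : R :=
  let w := opS L a c phi in
  p x + b * (\int[@lebesgue_measure R]_(t in `[0, L]) w t) * (w^`(2))%classic x.

(** * The constants M, N, q and K *)

Definition constM {R : realType} (L a c : R) : R :=
  1 + c * (L ^+ 3 / (12 * a) - L / a ^+ 2
           + 2 / a `^ (5 / 2) * tanh (Num.sqrt a * L / 2)).

Definition constN {R : realType} (L a c : R) : R :=
  1 + c * (5 * L ^+ 3 / (24 * a) - L / a ^+ 2
           + 1 / a `^ (5 / 2) * (2 - a * L ^+ 2 / 4)
             * tanh (Num.sqrt a * L / 2)).

Definition constq {R : realType} (L a b c : R) (p : R -> R) : R :=
  normL1 L p * (b * L ^+ 2 * constN L a c / (2 * a ^+ 2 * constM L a c ^+ 2)).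

Definition constK {R : realType} (L a c : R) : R :=
  (2 * constM L a c - 1) / constM L a c * (L ^+ 2 / (8 * a)).

(* Main.v *)
(** The map A is a contraction of ratio q on the ball.  All norm estimates come
    from Green's identity for w'''' - a w'' tested against the solution zeta of
    zeta'''' - a zeta'' = 1 (hinged ends), together with the maximum principle:
    if v solves the equation with source f, then |v| and |v''| are dominated by
    the solution with source |f|, so that the integrals of |v| and |v''| are at
    most those of |f| zeta and - |f| zeta''.

    For p >= 0, a solution u with integral I >= 0 solves
    u'''' - (a + b I) u'' = p - c I; testing against the corresponding function
    zeta_I gives the scalar equation I + c int (I zeta_I) = int (p zeta_I).  By
    the maximum principle zeta_I is nonincreasing in I whereas I zeta_I is
    nondecreasing, so that I, and then u, is unique.

    The calculus of absolutely continuous functions rests on the fact that such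
    a function is nondecreasing when its derivative is almost everywhere
    nonnegative. *)

Require Import Defs.
From HB Require Import structures.
From mathcomp Require Import all_boot all_order all_algebra.
From mathcomp Require Import all_classical all_reals all_analysis.
From mathcomp Require Import measurable_realfun ring lra.

Set Implicit Arguments.
Unset Strict Implicit.
Unset Printing Implicit Defensive.

Import Order.TTheory GRing.Theory Num.Theory.
Import numFieldNormedType.Exports.

Local Open Scope classical_set_scope.
Local Open Scope ring_scope.

(** * Absolutely continuous functions *)

Section absolute_continuity.
Context {R : realType}.
Implicit Types (L : R) (f g h : R -> R).
Local Notation mu := (@lebesgue_measure R).

(** The threshold on the norm of [p] comes from treating I w'', with I the integral of w, as a
    bilinear term. Pointwise, 0 <= zeta <= L^2/(8a) and 0 <= - zeta'' <= 1/a. A solution w of the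
    linear nonlocal problem with source f is v - c I zeta, where v solves the same problem without
    the integral term. Integrating gives I M = int (f zeta) with M = 1 + c int zeta, hence |I| <=
    L^2/(8aM) |f|_1; differentiating twice gives |w''|_1 <= N/(aM) |f|_1 with N = M + (c L^2/8) int
    (- zeta''). On the ball of radius 2|p|_1 the term b I w'' therefore has Lipschitz constant 2 b
    (2|p|_1) L^2/(8aM) N/(aM) = q. The sign of I is not built into the ball. Solutions are only
    W^{4,1}, so each integration by parts is done by exhibiting one absolutely continuous
    antiderivative. *)

Lemma disjoint_itvs (n : nat) (s t : 'I_n -> R) :
  (forall i j : 'I_n, (i < j)%N -> t i <= s j) ->
  trivIset setT (fun i => `]s i, t i]%classic).
Proof.
move=> ts; apply/trivIsetP => i j _ _ ij; rewrite -subset0 => x [/=].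
rewrite !in_itv/= => /andP[six xti] /andP[sjx xtj].
have [/ts h|/ts h|/val_inj ji] := ltngtP i j.
- by have := lt_le_trans (le_lt_trans h sjx) xti; rewrite ltxx.
- by have := lt_le_trans (le_lt_trans h six) xtj; rewrite ltxx.
- by rewrite ji eqxx in ij.
Qed.

Lemma measure_itvs (n : nat) (s t : 'I_n -> R) :
  (forall i, s i <= t i) ->
  (forall i j : 'I_n, (i < j)%N -> t i <= s j) ->
  mu (\big[setU/set0]_(i < n) `]s i, t i]%classic)
  = (\sum_(i < n) (t i - s i))%:E.
Proof.
move=> st ts; rewrite measure_bigsetU_ord//; last exact: disjoint_itvs.
rewrite -sumEFin; apply: eq_bigr => i _.
rewrite [LHS]lebesgue_measure_itv/= lte_fin; have [//|tsi] := ltP (s i) (t i).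
by have /eqP -> : s i == t i; [rewrite eq_le st|rewrite subrr].
Qed.

(** Outer regularity. It confines the points where a derivative misbehaves to an open set so small
    that absolute continuity makes the increments over it negligible. *)
Lemma null_set_open_cover (A : set R) (e : R) : measurable A -> mu A = 0%E ->
  0 < e -> exists U : set R, [/\ open U, A `<=` U & (mu U < e%:E)%E].
Proof.
move=> mA A0 e0.
have muA : (mu A < +oo)%E by rewrite A0.
have [U [oU AU mUA]] := lebesgue_regularity_outer mA muA e0.
exists U; split => //.
have mU : measurable U by exact: measurable_realfun.open_measurable.
have -> : mu U = mu (A `|` (U `\` A)) by rewrite setDUK.
rewrite measureU ?setDIK//; last exact: measurableD.
by move: mUA; rewrite -[X in (X < _)%E]add0e -A0.
Qed.

(** The difference quotient is used on each side of [x] separately; the errors [e (t - x)] and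
    [e (x - s)] add up to [e (t - s)], whatever the position of [x] between [s] and [t] (straddle
    lemma). *)
Lemma is_derive_lower_bound (F : R -> R) (x l e : R) :
  is_derive x (1 : R) F l -> 0 <= l -> 0 < e ->
  exists2 r : R, 0 < r & forall s t, x - r < s -> s <= x -> x <= t -> t < x + r ->
    - e * (t - s) <= F t - F s.
Proof.
move=> dF l0 e0.
have dFx : derivable F x 1 by exact: ex_derive.
have lE : 'D_1 F x = l by exact: derive_val.
have : (fun h : R => h^-1 *: ((F \o shift x) (h *: 1) - F x)) @ 0^' --> l.
  by rewrite -lE; exact: dFx.
move/cvgrPdist_lt => /(_ e e0) /nbhs_ballP[r /= r0 hr].
exists r => // s t rs sx xt tr.
have key y : `|y - x| < r -> `|F y - F x - l * (y - x)| <= e * `|y - x|.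
  move=> yx; have [->|yNx] := eqVneq y x; first by rewrite !subrr mulr0 subr0 normr0 mulr0.
  have yx0 : y - x != 0 by rewrite subr_eq0.
  have /= := hr (y - x); rewrite /ball/= sub0r normrN => /(_ yx yx0).
  rewrite /GRing.scale/= mulr1 subrK => /ltW h.
  rewrite -ler_pdivrMr ?normr_gt0// -normf_div.
  by rewrite distrC in h; apply: le_trans h; rewrite mulrBl mulfK// [_^-1 * _]mulrC.
have /ler_normlP[h1 _] : `|F t - F x - l * (t - x)| <= e * (t - x).
  have xt' : `|t - x| = t - x by rewrite ger0_norm ?subr_ge0.
  by rewrite -[X in _ <= e * X]xt' key// xt' ltrBlDl.
have /ler_normlP[_ h2] : `|F s - F x - l * (s - x)| <= e * (x - s).
  have xs : `|s - x| = x - s by rewrite distrC ger0_norm ?subr_ge0.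
  by rewrite -xs key// xs ltrBlDr -ltrBlDl.
have : 0 <= l * (t - x) by rewrite mulr_ge0 ?subr_ge0.
have : 0 <= l * (x - s) by rewrite mulr_ge0 ?subr_ge0.
nra.
Qed.

End absolute_continuity.

(** * Monotonicity from an almost everywhere nonnegative derivative *)

Section nondecreasing.
Context {R : realType}.
Implicit Types (L : R) (f g h : R -> R).
Local Notation mu := (@lebesgue_measure R).

(** Continuous induction through the supremum of the points where [P] holds. The local step runs
    from any nearby [s] left of [c] to any nearby [t] right of it, so it serves both to reach the
    supremum and to pass it. *)
Lemma real_induction (P : R -> Prop) (x y : R) : x <= y -> P x ->
  (forall c, x <= c -> c <= y -> exists2 r : R, 0 < r &
     forall s t, x <= s -> t <= y -> c - r < s -> s <= c -> c <= t -> t < c + r ->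
       P s -> P t) ->
  P y.
Proof.
move=> xy Px h.
pose S := [set z | [/\ x <= z, z <= y & P z]].
have Sx : S x by split.
have supS : has_sup S by split; [exists x|exists y => z []].
have xS : x <= sup S by apply: (sup_ubound supS.2).
have Sy : sup S <= y by apply: sup_le_ub; [exists x|move=> z []].
have [r r0 hr] := h _ xS Sy.
have [s [xs sy Ps] rs] := sup_adherent r0 supS.
have sS : s <= sup S by apply: (sup_ubound supS.2).
(* [P t] will put [t] at or below the supremum, which is possible only if the minimum is [y]. *)
set t := Num.min y (sup S + r / 2).
have r20 : 0 < r / 2 by rewrite divr_gt0.
have Pt : P t.
  apply: (hr s) => //; rewrite /t.
  - by rewrite ge_min lexx.
  - by rewrite le_min Sy lerDl ltW.
  - by rewrite gt_min ltrD2l [r / 2 < r]ltr_pdivrMr// ltr_pMr// ltr1n orbT.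
have : t <= sup S.
  apply: (sup_ubound supS.2); split => //; rewrite /t.
    by rewrite le_min xy (le_trans xS)// lerDl ltW.
  by rewrite ge_min lexx.
rewrite /t ge_min => /orP[yS|].
  suff -> : y = t by [].
  rewrite /t; apply/esym/min_idPl; rewrite (le_trans yS)// lerDl ltW//.
by rewrite leNgt ltrDl r20.
Qed.

(** A point where [f] is a nonnegative derivative allows a step that loses at most [e] per unit of
    length; a point of the exceptional null set allows a step inside [U], and all such steps
    together lose less than [e] by absolute continuity. *)
Lemma ac_nondecreasing L (F f : R -> R) (x y : R) : abs_continuous L F ->
  0 <= x -> x <= y -> y <= L ->
  {ae mu, forall z : R, z \in `]x, y[ -> is_derive z (1 : R) F (f z)} ->
  {ae mu, forall z : R, z \in `]x, y[ -> 0 <= f z} ->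
  F x <= F y.
Proof.
move=> acF x0 xy yL [A [mA A0 hA]] [B [mB B0 hB]].
apply/ler_addgt0Pr => e' e'0.
have yx1 : 0 < y - x + 1 by rewrite ltr_wpDl// subr_ge0.
(* Makes the two losses [e (y - x)] and [e] add up to [e']. *)
pose e := e' / (y - x + 1).
have e0 : 0 < e by rewrite divr_gt0.
have [d d0 acd] := acF e e0.
(* The endpoints join the exceptional set, since the hypotheses speak of the open interval only. *)
pose E := A `|` B `|` [set x] `|` [set y].
have mE : measurable E by do 3 (apply: measurableU => //).
have E0 : mu E = 0%E.
  apply: (measure_negligible mE).
  apply: negligibleU; [apply: negligibleU; [apply: negligibleU|]|];
    apply/negligibleP => //.
  - exact: lebesgue_measure_set1.
  - exact: lebesgue_measure_set1.
have [U [oU EU mUd]] := null_set_open_cover mE E0 d0.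
(* Q z: F z - F x is bounded below up to the increments of F over finitely many
   disjoint intervals contained in U, which have small total length. *)
pose Q z := exists n (s t : nat -> R), [/\
  forall i, (i < n)%N -> [/\ x <= s i, s i <= t i, t i <= z & `[s i, t i] `<=` U],
  forall i j, (i < j)%N -> (j < n)%N -> t i <= s j &
  - e * (z - x) - \sum_(i < n) `|F (t i) - F (s i)| <= F z - F x].
have : Q y.
  apply: (real_induction xy).
    exists 0%N, (fun=> 0), (fun=> 0); split => //.
    by rewrite big_ord0 !subrr mulr0 subr0.
  move=> c xc cy.
  (* In the exceptional set, [[s, t]] is appended to the list and pays for its own increment;
     elsewhere the list is kept and the differentiability bound is used. *)
  have [Ec|Ec] := pselect (E c).
  - have /nbhs_ballP[r /= r0 rU] : nbhs c U by apply: open_nbhs_nbhs; split => //; exact: EU.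
    exists r => // s t xs ty rs sc ct tr [n [u [v [h1 h2 h3]]]].
    exists n.+1, (fun i => if i == n then s else u i),
      (fun i => if i == n then t else v i); split.
    + move=> i; rewrite ltnS leq_eqVlt; have [->|ni] /= := eqVneq i n => iltn.
        split=> //; first by rewrite (le_trans sc).
        move=> z /=; rewrite in_itv/= => /andP[sz zt]; apply: rU.
        by rewrite /ball/= ltr_norml; apply/andP; split; lra.
      have [? ? ? ?] := h1 i iltn; split => //; lra.
    + move=> i j ij; rewrite ltnS => jn.
      rewrite [i == n]ltn_eqF; last exact: leq_trans jn.
      have [jE|nj] := eqVneq j n; first by have [] := h1 i; rewrite -?jE.
      by apply: h2 => //; rewrite ltn_neqAle nj.
    + rewrite big_ord_recr/= eqxx.
      under eq_bigr => i _ do rewrite [_ == n]ltn_eqF//.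
      have := ler_norm (- (F t - F s)); rewrite normrN.
      have : 0 <= e * (t - s) by rewrite mulr_ge0 ?(ltW e0)// subr_ge0; lra.
      move: h3; set sm := \sum_(i < n) _; lra.
  - have cA : c \in `]x, y[.
      rewrite in_itv/= !lt_neqAle xc cy !andbT.
      by apply/andP; split; apply/eqP => H; apply: Ec; rewrite /E H; [left; right|right].
    have dc : is_derive c (1 : R) F (f c).
      by apply: contrapT => H; apply: Ec; left; left; left; apply: hA => /= /(_ cA).
    have fc : 0 <= f c.
      apply: contrapT => H; apply: Ec; left; left; right.
      by apply: hB => /= /(_ cA).
    have [r r0 hr] := is_derive_lower_bound dc fc e0.
    exists r => // s t xs ty rs sc ct tr [n [u [v [h1 h2 h3]]]].
    have := hr _ _ rs sc ct tr => h4.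
    exists n, u, v; split => //.
      move=> i /h1[? ? ? ?]; split => //; lra.
    move: h3; set sm := \sum_(i < n) _; lra.
move=> [n [s [t [h1 h2 h3]]]].
have sums : \sum_(i < n) `|F (t i) - F (s i)| < e.
  apply: (acd n (fun i => s i) (fun i => t i)).
  - by move=> i; have [] := h1 i (ltn_ord i); split => //; lra.
  - by move=> i j ij; apply: h2.
  (* The intervals are disjoint and lie in [U], so their total length is at most [mu U < d]. *)
  - rewrite -lte_fin -measure_itvs.
    + apply: le_lt_trans mUd; apply: le_measure; rewrite ?inE.
      * by apply: bigsetU_measurable => i _.
      * exact: measurable_realfun.open_measurable.
      rewrite -bigcup_seq => z [i _ /=]; rewrite in_itv/= => /andP[/ltW sz zt].
      by have [_ _ _] := h1 i (ltn_ord i); apply; rewrite /= in_itv/= sz.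
    + by move=> i; have [] := h1 i (ltn_ord i).
    + by move=> i j ij; apply: h2.
have : e * (y - x) + e = e' by rewrite /e -[X in _ + X]mulr1 -mulrDr divfK// gt_eqF.
move: h3 sums; set sm := \sum_(i < n) _; lra.
Qed.
End nondecreasing.

(** * Integrable functions on [0,L] and almost everywhere comparison of integrals *)

Section L1.
Context {R : realType}.
Implicit Types (L x y k : R) (f g h : R -> R).
Local Notation mu := (@lebesgue_measure R).

Lemma ae_mp (P Q : R -> Prop) : (forall x, P x -> Q x) ->
  {ae mu, forall x, P x} -> {ae mu, forall x, Q x}.
Proof. by apply: filterS; exact: (ae_filter_ringOfSetsType mu). Qed.

Lemma ae_mp2 (P Q S : R -> Prop) : (forall x, P x -> Q x -> S x) ->
  {ae mu, forall x, P x} -> {ae mu, forall x, Q x} -> {ae mu, forall x, S x}.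
Proof. by apply: filterS2; exact: (ae_filter_ringOfSetsType mu). Qed.

Lemma inL1_ext L f g : {in `[0, L], f =1 g} -> inL1 L f -> inL1 L g.
Proof.
by move=> fg; apply: eq_integrable => // x; rewrite inE => xL /=; rewrite fg.
Qed.

Lemma inL1D L f g : inL1 L f -> inL1 L g -> inL1 L (fun x => f x + g x).
Proof. by move=> If Ig; exact: (integrableD _ If Ig). Qed.

Lemma inL1Z L k f : inL1 L f -> inL1 L (fun x => k * f x).
Proof. by move=> If; exact: (integrableZl _ k If). Qed.

Lemma inL1B L f g : inL1 L f -> inL1 L g -> inL1 L (fun x => f x - g x).
Proof. by move=> If Ig; exact: (integrableB _ If Ig). Qed.

Lemma inL1N L f : inL1 L f -> inL1 L (fun x => - f x).
Proof. by move=> If; exact: (integrableN If). Qed.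

Lemma inL1_norm L f : inL1 L f -> inL1 L (fun x => `|f x|).
Proof. exact: integrable_norm. Qed.

Lemma ae_neq (a : R) : {ae mu, forall x, x <> a}.
Proof.
exists [set a]; split => //; first exact: lebesgue_measure_set1.
by move=> x /= /contrapT.
Qed.

Lemma ae_itv L (P : R -> Prop) :
  {ae mu, forall x, x \in `]0, L[ -> P x} ->
  {ae mu, forall x, x \in `[0, L] -> P x}.
Proof.
move=> h; have := ae_mp2 (fun x => @conj _ _) (ae_neq 0) (ae_neq L).
apply: ae_mp2 h => x h [/eqP x0 /eqP xL]; rewrite in_itv/= => /andP[x0' xL'].
by apply: h; rewrite in_itv/= !lt_neqAle x0' xL' eq_sym x0 xL.
Qed.

Lemma ae_int_eq L f g : inL1 L f -> inL1 L g ->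
  {ae mu, forall x, x \in `[0, L] -> f x = g x} ->
  \int[mu]_(x in `[0, L]) f x = \int[mu]_(x in `[0, L]) g x.
Proof.
move=> If Ig fg; congr fine; apply: ae_eq_integral => //.
- exact: measurable_int If.
- exact: measurable_int Ig.
- by apply: ae_mp fg => x fgx xL /=; rewrite fgx.
Qed.

Lemma ae_int_ge0 L f : inL1 L f -> {ae mu, forall x, x \in `[0, L] -> 0 <= f x} ->
  0 <= \int[mu]_(x in `[0, L]) f x.
Proof.
move=> If f0; rewrite (@ae_int_eq L f (fun x => `|f x|))//.
- by apply: Rintegral_ge0.
- exact: inL1_norm.
- by apply: ae_mp f0 => x h xL; rewrite ger0_norm// h.
Qed.

Lemma ae_int_le L f g : inL1 L f -> inL1 L g ->
  {ae mu, forall x, x \in `[0, L] -> f x <= g x} ->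
  \int[mu]_(x in `[0, L]) f x <= \int[mu]_(x in `[0, L]) g x.
Proof.
move=> If Ig fg; rewrite -subr_ge0 -RintegralB//; apply: ae_int_ge0.
  exact: inL1B.
by apply: ae_mp fg => x h xL; rewrite subr_ge0 h.
Qed.

End L1.

(** * Closure properties of absolutely continuous functions *)

Section AC.
Context {R : realType}.
Implicit Types (L x y k : R) (f g h : R -> R).
Local Notation mu := (@lebesgue_measure R).

Lemma ac_continuous L f : abs_continuous L f -> {within `[0, L], continuous f}.
Proof.
move=> acf; apply/subspace_continuousP => x /=; rewrite in_itv/= => /andP[x0 xL].
apply/cvgrPdist_lt => e e0; have [d d0 hd] := acf e e0.
rewrite near_withinE; exists d => //= y yd; rewrite in_itv/= => /andP[y0 yL].
wlog xy : x y x0 xL y0 yL yd / x <= y.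
  move=> H; have [|/ltW] := leP x y; first exact: H.
  by rewrite distrC; apply: H => //; rewrite /ball/= distrC.
have := hd 1%N (fun=> x) (fun=> y); rewrite !big_ord1 distrC; apply => //.
- by move=> i j; rewrite !ord1.
- by move: yd; rewrite /ball/= distrC ger0_norm ?subr_ge0.
Qed.

Lemma ac_bounded L f : abs_continuous L f ->
  exists2 B : R, 0 < B & forall x, 0 <= x -> x <= L -> `|f x| <= B.
Proof.
move=> /ac_continuous cf.
have /compact_bounded[M [_ hM]] := continuous_compact cf (@segment_compact _ 0 L).
exists (`|M| + 1); first by rewrite ltr_wpDl.
move=> x x0 xL; apply: (hM (`|M| + 1)); first by rewrite ltr_pwDr// ler_norm.
by exists x => //=; rewrite in_itv/= x0.
Qed.

Lemma inL1_ac L f : abs_continuous L f -> inL1 L f.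
Proof.
move=> /ac_continuous cf.
exact: (continuous_compact_integrable (@segment_compact _ 0 L) cf).
Qed.

Lemma inL1M L f g : abs_continuous L f -> inL1 L g ->
  inL1 L (fun x => f x * g x).
Proof.
move=> acf Ig; have [B B0 hB] := ac_bounded acf.
have bf : [bounded f x | x in `[0, L]%classic].
  exists B; split; first exact: num_real.
  move=> C BC x /=; rewrite in_itv/= => /andP[x0 xL].
  by rewrite (le_trans (hB _ x0 xL))// ltW.
have := @integrableMr _ _ R mu `[0, L]%classic _ f (EFin \o g) _ bf Ig.
apply => //; apply/measurable_EFinP.
exact: measurable_int (inL1_ac acf).
Qed.

Lemma inL1_cst L k : inL1 L (fun=> k).
Proof.
apply: inL1_ac => e e0; exists 1 => // n s t _ _ _.
by rewrite big1// => i _; rewrite subrr normr0.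
Qed.

Lemma acD L f g : abs_continuous L f -> abs_continuous L g ->
  abs_continuous L (fun x => f x + g x).
Proof.
move=> acf acg e e0; have e20 : 0 < e / 2 by rewrite divr_gt0.
have [d1 d10 h1] := acf _ e20; have [d2 d20 h2] := acg _ e20.
exists (Num.min d1 d2); first by rewrite lt_min d10.
move=> n s t st ts; rewrite lt_min => /andP[/h1 - /(_ st ts) k1 /h2 - /(_ st ts) k2].
rewrite [e]splitr (le_lt_trans _ (ltrD k1 k2))// -big_split/= ler_sum// => i _.
by rewrite (le_trans _ (ler_normD _ _))// opprD addrACA.
Qed.

Lemma acM L f g : abs_continuous L f -> abs_continuous L g ->
  abs_continuous L (fun x => f x * g x).
Proof.
move=> acf acg e e0.
have [B B0 hB] := ac_bounded acf; have [C C0 hC] := ac_bounded acg.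
have eB : 0 < e / 2 / B by rewrite !divr_gt0.
have eC : 0 < e / 2 / C by rewrite !divr_gt0.
have [d1 d10 h1] := acf _ eC; have [d2 d20 h2] := acg _ eB.
exists (Num.min d1 d2); first by rewrite lt_min d10.
move=> n s t st ts; rewrite lt_min => /andP[/h1 - /(_ st ts) k1 /h2 - /(_ st ts) k2].
have -> : e = (e / 2 / C) * C + B * (e / 2 / B).
  by rewrite [B * _]mulrC !divfK ?gt_eqF// -splitr.
apply: (@le_lt_trans _ _ ((\sum_(i < n) `|f (t i) - f (s i)|) * C +
    B * (\sum_(i < n) `|g (t i) - g (s i)|))); last first.
  by rewrite ltrD// ?ltr_pM2r ?ltr_pM2l.
rewrite mulr_suml mulr_sumr -big_split/= ler_sum// => i _.
have [s0 si tL] := st i.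
have -> : f (t i) * g (t i) - f (s i) * g (s i) =
  (f (t i) - f (s i)) * g (t i) + f (s i) * (g (t i) - g (s i)) by ring.
rewrite (le_trans (ler_normD _ _))// !normrM lerD//.
  by rewrite ler_wpM2l// hC// (le_trans s0).
by rewrite ler_wpM2r// hB// (le_trans si).
Qed.

Lemma ac_cst L k : abs_continuous L (fun=> k).
Proof.
move=> e e0; exists 1 => // n s t _ _ _.
by rewrite big1// => i _; rewrite subrr normr0.
Qed.

Lemma ac_ext L f g : {in `[0, L], f =1 g} -> abs_continuous L f -> abs_continuous L g.
Proof.
move=> fg acf e /acf[d d0 hd]; exists d => // n s t st ts /(hd _ _ _ st ts).
congr (_ < _); apply: eq_bigr => i _; have [s0 si tL] := st i.
by rewrite !fg// in_itv/=; apply/andP; split => //; lra.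
Qed.

Lemma ac_lipschitz L f (B : R) : 0 < B ->
  (forall x y, 0 <= x -> x <= y -> y <= L -> `|f y - f x| <= B * (y - x)) ->
  abs_continuous L f.
Proof.
move=> B0 fB e e0; exists (e / B); first exact: divr_gt0.
move=> n s t st ts; rewrite ltr_pdivlMr// mulrC; apply: le_lt_trans.
by rewrite mulr_sumr ler_sum// => i _; have [] := st i; exact: fB.
Qed.

End AC.

(** * Sobolev functions of order one *)

Section W11.
Context {R : realType}.
Implicit Types (L x y k : R) (f g h : R -> R).
Local Notation mu := (@lebesgue_measure R).

Definition primitive f x : R := \int[mu]_(t in `[0, x]) f t.

Lemma primitive0 f : primitive f 0 = 0.
Proof. by rewrite /primitive set_itv1 Rintegral_set1. Qed.

Lemma primitive_sub L f x y : inL1 L f -> 0 <= x -> x <= y -> y <= L ->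
  primitive f y - primitive f x = \int[mu]_(t in `]x, y]) f t.
Proof.
move=> If x0 xy yL; apply: Rintegral_itvB; rewrite ?bnd_simp//.
apply: (integrableS _ _ _ If) => // z /=; rewrite !in_itv/= => /andP[-> zy].
exact: le_trans yL.
Qed.

(** Extension by zero: the absolute continuity of the integral and the differentiation theorem are
    applied on the whole line. *)
Lemma integrable_patch L f : inL1 L f ->
  mu.-integrable setT (EFin \o (f \_ `[0, L])).
Proof. by move=> If; rewrite -restrict_EFin -integrable_mkcond. Qed.

Lemma Rintegral_bigsetU n (A : 'I_n -> set R) g :
  mu.-integrable setT (EFin \o g) -> (forall i, measurable (A i)) ->
  trivIset setT A ->
  \int[mu]_(x in \big[setU/set0]_(i < n) A i) g x =
  \sum_(i < n) \int[mu]_(x in A i) g x.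
Proof.
move=> Ig mA tA.
have mU : measurable (\big[setU/set0]_(i < n) A i) by exact: bigsetU_measurable.
have Ig' B : measurable B -> mu.-integrable B (EFin \o g).
  by move=> mB; exact: integrableS Ig.
apply: EFin_inj; rewrite -sumEFin /Rintegral fineK; last first.
  by apply: integrable_fin_num => //; exact: Ig'.
under [RHS]eq_bigr => i _.
  rewrite fineK; last by apply: integrable_fin_num; [exact: mA|apply: Ig'; exact: mA].
  over.
rewrite integral_bigsetU_EFin//.
- exact: index_enum_uniq.
- exact: sub_trivIset tA.
- by case/integrableP: (Ig' _ mU).
Qed.

(** Absolute continuity of the integral of [|f|], applied to the union of the intervals. *)
Lemma ac_primitive L f : inL1 L f -> abs_continuous L (primitive f).
Proof.
move=> If e e0; have Ih := integrable_patch If.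
have [d [d0 hd]] := integral_normr_continuous Ih e0.
exists d => // n s t st ts sd.
have mA i : measurable (`]s i, t i]%classic : set R) by [].
apply: le_lt_trans (hd (\big[setU/set0]_(i < n) `]s i, t i]%classic) _ _); last 2 first.
- exact: bigsetU_measurable.
- by move: sd; rewrite -lte_fin -measure_itvs// => i; have [] := st i.
rewrite Rintegral_bigsetU//; last 2 first.
- exact: integrable_norm Ih.
- exact: disjoint_itvs.
apply: ler_sum => i _; have [s0 si tL] := st i.
rewrite (primitive_sub If)//.
have fh : {in `]s i, t i]%classic, f =1 f \_ `[0, L]}.
  move=> x; rewrite inE/= in_itv/= => /andP[sx xt].
  rewrite patchE mem_set//= in_itv/=; apply/andP; split; lra.
have -> : \int[mu]_(x in `]s i, t i]) f x =
    \int[mu]_(x in `]s i, t i]) (f \_ `[0, L]) x by exact: eq_Rintegral.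
apply: le_normr_Rintegral => //.
exact: integrableS Ih.
Qed.

Lemma is_derive_ext_oo L f g x l : x \in `]0, L[ -> {in `[0, L], f =1 g} ->
  is_derive x (1 : R) f l -> is_derive x (1 : R) g l.
Proof.
move=> xL fg; apply: near_eq_is_derive.
have : nbhs x `]0, L[%classic by apply: open_nbhs_nbhs; split => //; exact: interval_open.
apply: filterS => y yL; apply: fg.
by move: yL; rewrite /= !in_itv/= => /andP[/ltW -> /ltW ->].
Qed.

Lemma W11_primitive L f : inL1 L f -> W11_deriv L (primitive f) f.
Proof.
move=> If; split => //; first exact: ac_primitive.
have Ih := integrable_patch If.
have Ihy y : mu.-integrable [set` Interval (BLeft 0) (BRight y)] (EFin \o (f \_ `[0, L])).
  exact: integrableS Ih.
have loc : locally_integrable [set: R] (f \_ `[0, L]) by exact: integrable_locally.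
have := FTC1 Ihy loc.
apply: ae_mp => x /= h xL; have := xL; rewrite in_itv/= => /andP[x0 x1].
have [dF Fx] := h x0.
apply: (is_derive_ext_oo xL (f := primitive (f \_ `[0, L]))).
  move=> y; rewrite in_itv/= => /andP[y0 yL].
  apply: eq_Rintegral => z; rewrite inE/= in_itv/= => /andP[z0 zy].
  by rewrite patchE mem_set//= in_itv/= z0 (le_trans zy).
apply: DeriveDef => //; rewrite -derive1E [LHS]Fx patchE mem_set//=.
by rewrite in_itv/= !ltW.
Qed.

Lemma W11_ext L f f' g : {in `[0, L], f =1 f'} -> W11_deriv L f g -> W11_deriv L f' g.
Proof.
move=> ff' [acf Ig df]; split => //; first exact: ac_ext acf.
by apply: ae_mp df => x h xL; apply: (is_derive_ext_oo xL ff'); exact: h.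
Qed.

Lemma W11_ae L f g g' : inL1 L g' ->
  {ae mu, forall x, x \in `]0, L[ -> g x = g' x} ->
  W11_deriv L f g -> W11_deriv L f g'.
Proof.
move=> Ig' gg' [acf Ig df]; split => //.
by apply: ae_mp2 df gg' => x h + xL => /(_ xL) <-; exact: h.
Qed.

Lemma W11_eq L f g g' : {in `[0, L], g =1 g'} ->
  W11_deriv L f g -> W11_deriv L f g'.
Proof.
move=> gg' H; apply: W11_ae (H); first by case: H => _ + _; exact: inL1_ext.
by apply: aeW => x; rewrite in_itv/= => /andP[/ltW x0 /ltW xL]; rewrite gg'// in_itv/= x0.
Qed.

Lemma W11D L f f' g g' : W11_deriv L f f' -> W11_deriv L g g' ->
  W11_deriv L (fun x => f x + g x) (fun x => f' x + g' x).
Proof.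
move=> [acf If df] [acg Ig dg]; split; [exact: acD|exact: inL1D|].
by apply: ae_mp2 df dg => x hf hg xL; apply: is_deriveD; [exact: hf|exact: hg].
Qed.

Lemma W11_cst L k : W11_deriv L (fun=> k) (fun=> 0).
Proof.
split; [exact: ac_cst|exact: inL1_cst|].
by apply: aeW => x _; exact: is_derive_cst.
Qed.

Lemma W11M L f f' g g' : W11_deriv L f f' -> W11_deriv L g g' ->
  W11_deriv L (fun x => f x * g x) (fun x => f x * g' x + g x * f' x).
Proof.
move=> [acf If df] [acg Ig dg]; split; first exact: acM.
  by apply: inL1D; exact: inL1M.
apply: ae_mp2 df dg => x hf hg xL.
have := is_deriveM (hf xL) (hg xL); exact.
Qed.

Lemma W11Z L k f f' : W11_deriv L f f' ->
  W11_deriv L (fun x => k * f x) (fun x => k * f' x).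
Proof.
move=> H; apply: W11_eq (W11M (W11_cst L k) H) => x _ /=.
by rewrite mulr0 addr0.
Qed.

Lemma W11B L f f' g g' : W11_deriv L f f' -> W11_deriv L g g' ->
  W11_deriv L (fun x => f x - g x) (fun x => f' x - g' x).
Proof.
move=> Hf /(W11Z (-1)) Hg; have := W11D Hf Hg.
under eq_fun do rewrite mulN1r.
by under [X in W11_deriv _ _ X]eq_fun do rewrite mulN1r.
Qed.

Lemma W11_nondecreasing L f g x y : W11_deriv L f g ->
  0 <= x -> x <= y -> y <= L ->
  {ae mu, forall z, z \in `]x, y[ -> 0 <= g z} -> f x <= f y.
Proof.
move=> [acf _ df] x0 xy yL; apply: (ac_nondecreasing acf) => //.
apply: ae_mp df => z h; rewrite in_itv/= => /andP[xz zy]; apply: h.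
by rewrite in_itv/=; apply/andP; split; lra.
Qed.

Lemma W11_constant L f : W11_deriv L f (fun=> 0) ->
  forall x, x \in `[0, L] -> f x = f 0.
Proof.
move=> Hf x; rewrite in_itv/= => /andP[x0 xL].
have : f 0 <= f x by apply: (W11_nondecreasing Hf) => //; exact: aeW.
have := W11Z (-1) Hf; rewrite mulr0 => Hf'.
have : -1 * f 0 <= -1 * f x by apply: (W11_nondecreasing Hf') => //; exact: aeW.
lra.
Qed.

(** The difference with [primitive g] has zero derivative, hence is constant. *)
Lemma W11_FTC L f g x : W11_deriv L f g -> x \in `[0, L] ->
  f x = f 0 + primitive g x.
Proof.
move=> Hf xL; have [_ Ig _] := Hf.
have := W11B Hf (W11_primitive Ig).
under [X in W11_deriv _ _ X]eq_fun do rewrite subrr.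
by move=> /W11_constant /(_ x xL); rewrite primitive0 subr0 => <-; rewrite subrK.
Qed.

Lemma W11_integral L f g : 0 <= L -> W11_deriv L f g ->
  \int[mu]_(x in `[0, L]) g x = f L - f 0.
Proof.
move=> L0 Hf; rewrite [f L](W11_FTC Hf) ?in_itv/= ?lexx ?L0//.
by rewrite addrC addKr.
Qed.

(** On [0,L] [f] is a constant plus the primitive of a continuous function, so almost everywhere
    becomes everywhere. This makes Fermat's rule usable in [max_principle] and identifies the
    classical second derivative in [opA]. *)
Lemma W11_is_derive L f g : W11_deriv L f g -> abs_continuous L g ->
  forall x, x \in `]0, L[ -> is_derive x (1 : R) f (g x).
Proof.
move=> Hf acg x xL; have := xL; rewrite in_itv/= => /andP[x0 xL'].
have L0 := lt_trans x0 xL'.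
apply: (is_derive_ext_oo xL (f := fun y => f 0 + primitive g y)).
  by move=> y yL; rewrite -(W11_FTC Hf).
rewrite -[g x]add0r; apply: is_deriveD.
have cg := within_continuous_continuous L0 (ac_continuous acg) xL.
have [dF Fx] := continuous_FTC1_closed xL' (inL1_ac acg) x0 cg.
by apply: DeriveDef => //; rewrite -derive1E [LHS]Fx.
Qed.

(** The mean value theorem makes [f] Lipschitz, [g] being bounded on the compact interval. *)
Lemma W11_smooth L f g : (forall x, is_derive x (1 : R) f (g x)) ->
  continuous g -> W11_deriv L f g.
Proof.
move=> df cg.
have cg' : {within `[0, L], continuous g} by exact: continuous_subspaceT.
have Ig : inL1 L g.
  exact: (continuous_compact_integrable (@segment_compact _ 0 L) cg').
split => //; last by apply: aeW.
have /compact_bounded[M [_ hM]] := continuous_compact cg' (@segment_compact _ 0 L).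
have B0 : 0 < `|M| + 1 by rewrite ltr_wpDl.
apply: (ac_lipschitz B0) => x y x0 xy yL.
have [->|xNy] := eqVneq x y; first by rewrite !subrr normr0 mulr0.
have xy' : x < y by rewrite lt_neqAle xNy.
have [|c cxy ->] := MVT xy' (fun z _ => df z).
  apply: derivable_within_continuous => z _; exact: ex_derive.
rewrite normrM [`|y - x|]ger0_norm ?subr_ge0// ler_wpM2r ?subr_ge0//.
apply: (hM (`|M| + 1)); first by rewrite ltr_pwDr// ler_norm.
exists c => //=; move: cxy; rewrite !in_itv/= => /andP[c0 c1].
by apply/andP; split; lra.
Qed.

End W11.

(** * Maximum principle and Green identities *)

Section beam.
Context {R : realType}.
Implicit Types (L al x y k : R) (f g h u v z : R -> R).
Local Notation mu := (@lebesgue_measure R).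

Lemma W11_nonincreasing L f g x y : W11_deriv L f g ->
  0 <= x -> x <= y -> y <= L ->
  {ae mu, forall w, w \in `]x, y[ -> g w <= 0} -> f y <= f x.
Proof.
move=> Hf x0 xy yL g0; rewrite -lerN2 -mulN1r -[leRHS]mulN1r.
apply: (W11_nondecreasing (W11Z (-1) Hf)) => //.
by apply: ae_mp g0 => w h wI; rewrite mulN1r oppr_ge0 h.
Qed.

(* From an interior minimum where z < 0, real induction to the right keeps
   z1 <= 0, so that z stays below its negative minimum up to L. *)
Lemma max_principle L al z z1 z2 : 0 <= L -> 0 <= al ->
  W11_deriv L z z1 -> W11_deriv L z1 z2 -> 0 <= z 0 -> 0 <= z L ->
  {ae mu, forall x, x \in `]0, L[ -> 0 <= al * z x - z2 x} ->
  forall x, x \in `[0, L] -> 0 <= z x.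
Proof.
move=> L0 al0 Hz Hz1 z0 zL h.
have [acz _ _] := Hz; have [acz1 _ _] := Hz1.
have [c cL minc] := EVT_min L0 (ac_continuous acz).
suff zc : 0 <= z c by move=> x xL; exact: le_trans (minc x xL).
rewrite leNgt; apply/negP => zc.
have /andP[c0 cL'] : (0 <= c) && (c <= L) by move: cL; rewrite in_itv.
have cI : c \in `]0, L[.
  rewrite in_itv/= !lt_neqAle c0 cL' !andbT; apply/andP; split; apply/eqP => cE.
    by move: zc; rewrite -cE ltNge z0.
  by move: zc; rewrite cE ltNge zL.
have L0' : 0 < L by move: cI; rewrite in_itv/= => /andP[]; exact: lt_trans.
have dz := W11_is_derive Hz acz1.
have z1c : z1 c = 0.
  have H : is_derive c (1 : R) z 0.
    apply: (derive1_at_min L0 _ cI) => //.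
      by move=> t /dz H; exact: ex_derive.
    by move=> t tI; apply: minc; move: tI; rewrite !in_itv/= => /andP[/ltW -> /ltW ->].
  have H' := dz _ cI.
  by rewrite -(@derive_val _ _ _ _ _ _ _ H') (@derive_val _ _ _ _ _ _ _ H).
have Nzc : 0 < - z c by lra.
(* Over a length below [d], [z] moves by less than [- z c]; starting at or below [z c] it stays
   negative, and there the hypothesis gives [z2 <= al z <= 0]. The radius [d / 2] below keeps
   [t - s] under [d]. *)
have [d d0 hd] := acz _ Nzc.
have d20 : 0 < d / 2 by rewrite divr_gt0.
suff [zLc _] : z L <= z c /\ z1 L <= 0 by lra.
apply: (real_induction (P := fun y => z y <= z c /\ z1 y <= 0) cL').
  by rewrite z1c !lexx.
move=> y cy yL; exists (d / 2) => // s t cs tL ys sy yt ty [zs z1s].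
have st : s <= t by exact: le_trans yt.
have neg w : s <= w -> w <= t -> z w < 0.
  move=> sw wt; have := hd 1%N (fun=> s) (fun=> w); rewrite !big_ord1.
  have -> : w - s < d = true by lra.
  move=> /(_ _ _ isT) H; have : `|z w - z s| < - z c.
    apply: H; first by split => //; lra.
    by move=> i j; rewrite !ord1.
  by move=> /ltr_normlP[_]; lra.
have z1le w : s <= w -> w <= t -> z1 w <= 0.
  move=> sw wt; apply: le_trans z1s.
  apply: (W11_nonincreasing Hz1) => //; [lra|lra|].
  apply: ae_mp h => b hb; rewrite in_itv/= => /andP[sb bw].
  have /hb : b \in `]0, L[ by rewrite in_itv/=; apply/andP; split; lra.
  have : z b < 0 by apply: neg; lra.
  move=> zb; have : al * z b <= 0 by rewrite mulr_ge0_le0// ltW.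
  lra.
split; last exact: z1le.
apply: le_trans zs; apply: (W11_nonincreasing Hz) => //; [lra|].
by apply: aeW => b; rewrite in_itv/= => /andP[/ltW sb /ltW bt]; exact: z1le.
Qed.

(* v'''' - al v'' = f with hinged ends; v1, v2, v3 are v', v'', v'''. *)
Definition beam_solution L al f v v1 v2 v3 : Prop :=
  W41_derivs L v v1 v2 v3 (fun x => f x + al * v2 x) /\
  [/\ v 0 = 0, v L = 0, v2 0 = 0 & v2 L = 0].

Lemma beam_solution_lincomb L al k f g v v1 v2 v3 u u1 u2 u3 :
  beam_solution L al f v v1 v2 v3 -> beam_solution L al g u u1 u2 u3 ->
  beam_solution L al (fun x => f x + k * g x)
    (fun x => v x + k * u x) (fun x => v1 x + k * u1 x)
    (fun x => v2 x + k * u2 x) (fun x => v3 x + k * u3 x).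
Proof.
move=> [[V V1 V2 V3] [v0 vL v20 v2L]] [[U U1 U2 U3] [u0 uL u20 u2L]].
split; last by rewrite v0 vL v20 v2L u0 uL u20 u2L mulr0 addr0.
split; try by apply: W11D => //; exact: W11Z.
by apply: W11_eq (W11D V3 (W11Z k U3)) => x _ /=; ring.
Qed.

Lemma beam_solution_source L al f g v v1 v2 v3 :
  inL1 L g -> {ae mu, forall x, x \in `[0, L] -> f x = g x} ->
  beam_solution L al f v v1 v2 v3 -> beam_solution L al g v v1 v2 v3.
Proof.
move=> Ig fg [[V V1 V2 V3] bc]; split => //; split => //.
apply: W11_ae V3; first by apply: inL1D => //; apply: inL1Z; case: V2 => /inL1_ac.
apply: ae_mp fg => x h xI; rewrite h//.
by move: xI; rewrite !in_itv/= => /andP[/ltW -> /ltW ->].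
Qed.

(** The hinged problem splits into two second-order ones: [y = - v2] satisfies [- y'' + al y = f]
    with zero end values, and then [- v'' = y]. The maximum principle is used once with [al] and
    once with 0. *)
Lemma beam_solution_sign L al f v v1 v2 v3 : 0 <= L -> 0 <= al ->
  beam_solution L al f v v1 v2 v3 ->
  {ae mu, forall x, x \in `[0, L] -> 0 <= f x} ->
  forall x, x \in `[0, L] -> 0 <= v x /\ v2 x <= 0.
Proof.
move=> L0 al0 [[V V1 V2 V3] [v0 vL v20 v2L]] f0.
have v2le x : x \in `[0, L] -> v2 x <= 0.
  move=> xL; rewrite -oppr_ge0 -mulN1r.
  apply: (max_principle L0 al0 (W11Z (-1) V2) (W11Z (-1) V3)) xL => /=.
  - by rewrite v20 mulr0.
  - by rewrite v2L mulr0.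
  - apply: ae_mp f0 => y h yL; rewrite (_ : _ - _ = f y); last by ring.
    by apply: h; move: yL; rewrite !in_itv/= => /andP[/ltW -> /ltW ->].
move=> x xL; split; last exact: v2le.
apply: (max_principle L0 (lexx 0) V V1) xL; rewrite ?v0 ?vL//.
apply: aeW => y yL; rewrite mul0r sub0r oppr_ge0 v2le//.
by move: yL; rewrite !in_itv/= => /andP[/ltW -> /ltW ->].
Qed.

Lemma beam_solution_le L al f g v v1 v2 v3 u u1 u2 u3 : 0 <= L -> 0 <= al ->
  beam_solution L al f v v1 v2 v3 -> beam_solution L al g u u1 u2 u3 ->
  {ae mu, forall x, x \in `[0, L] -> f x <= g x} ->
  forall x, x \in `[0, L] -> v x <= u x /\ u2 x <= v2 x.
Proof.
move=> L0 al0 Hv Hu fg x xL.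
have H := beam_solution_lincomb (-1) Hu Hv.
have [|] := beam_solution_sign L0 al0 H _ xL; last by split; lra.
by apply: ae_mp fg => y h yL; have := h yL; lra.
Qed.

Lemma beam_solution_unique L al f g v v1 v2 v3 u u1 u2 u3 : 0 <= L -> 0 <= al ->
  beam_solution L al f v v1 v2 v3 -> beam_solution L al g u u1 u2 u3 ->
  {ae mu, forall x, x \in `[0, L] -> f x = g x} ->
  forall x, x \in `[0, L] -> v x = u x /\ v2 x = u2 x.
Proof.
move=> L0 al0 Hv Hu fg x xL.
have [] := beam_solution_le L0 al0 Hv Hu _ xL.
  by apply: ae_mp fg => y h /h ->.
have [] := beam_solution_le L0 al0 Hu Hv _ xL.
  by apply: ae_mp fg => y h /h ->.
by move=> *; split; lra.
Qed.

Lemma beam_inL1 L al f v v1 v2 v3 :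
  beam_solution L al f v v1 v2 v3 -> inL1 L f.
Proof.
move=> [[V V1 V2 V3] _]; have [ac2 _ _] := V2; have [_ I4 _] := V3.
by apply: inL1_ext (inL1D I4 (inL1Z (- al) (inL1_ac ac2))) => x _; ring.
Qed.

Section green.
Variables (L al : R) (f v v1 v2 v3 g u u1 u2 u3 : R -> R).
Hypotheses (L0 : 0 <= L) (Hv : beam_solution L al f v v1 v2 v3)
  (Hu : beam_solution L al g u u1 u2 u3).

(** The expression [v u3 - v1 u2 + v2 u1 - v3 u - al (v u1 - v1 u)] has derivative [v g - f u], and
    each of its terms contains a factor that vanishes at both ends. *)
Lemma beam_green :
  \int[mu]_(x in `[0, L]) (f x * u x) = \int[mu]_(x in `[0, L]) (v x * g x).
Proof.
have [[V V1 V2 V3] [v0 vL v20 v2L]] := Hv.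
have [[U U1 U2 U3] [u0 uL u20 u2L]] := Hu.
have If := beam_inL1 Hv; have Ig := beam_inL1 Hu.
have [acv _ _] := V; have [acu _ _] := U.
have I1 : inL1 L (fun x => f x * u x).
  by apply: inL1_ext (inL1M acu If) => x _; rewrite mulrC.
have I2 : inL1 L (fun x => v x * g x) by exact: inL1M.
apply/eqP; rewrite -subr_eq0 -RintegralB// -oppr_eq0; apply/eqP.
have H := W11B (W11B (W11D (W11M V U3) (W11M V2 U1)) (W11D (W11M V1 U2) (W11M V3 U)))
  (W11Z al (W11B (W11M V U1) (W11M V1 U))).
have := W11_integral L0 H; rewrite v0 vL v20 v2L u0 uL u20 u2L.
rewrite !(mul0r,mulr0,addr0,subr0) => HH.
rewrite -mulN1r -RintegralZl//; last exact: inL1B.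
by rewrite -[RHS]HH; apply: eq_Rintegral => x _; ring.
Qed.

(** Same argument for the second-order equations of [v2] and [u2], with antiderivative
    [v2 u3 - v3 u2]. *)
Lemma beam_green2 :
  \int[mu]_(x in `[0, L]) (f x * u2 x) = \int[mu]_(x in `[0, L]) (v2 x * g x).
Proof.
have [[V V1 V2 V3] [v0 vL v20 v2L]] := Hv.
have [[U U1 U2 U3] [u0 uL u20 u2L]] := Hu.
have If := beam_inL1 Hv; have Ig := beam_inL1 Hu.
have [acv _ _] := V2; have [acu _ _] := U2.
have I1 : inL1 L (fun x => f x * u2 x).
  by apply: inL1_ext (inL1M acu If) => x _; rewrite mulrC.
have I2 : inL1 L (fun x => v2 x * g x) by exact: inL1M.
apply/eqP; rewrite -subr_eq0 -RintegralB// -oppr_eq0; apply/eqP.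
have H := W11B (W11M V2 U3) (W11M V3 U2).
have := W11_integral L0 H; rewrite v20 v2L u20 u2L.
rewrite !(mul0r,mulr0,addr0,subr0) => HH.
rewrite -mulN1r -RintegralZl//; last exact: inL1B.
by rewrite -[RHS]HH; apply: eq_Rintegral => x _; ring.
Qed.

End green.
End beam.

(** * The Green function *)

Section kernel.
Context {R : realType}.
Implicit Types (L al x y k : R) (f g h u v z phi : R -> R).
Local Notation mu := (@lebesgue_measure R).

Lemma W11_expR L k : W11_deriv L (fun x => expR (k * x)) (fun x => k * expR (k * x)).
Proof.
have D (x : R) : is_derive x (1 : R) (fun x => expR (k * x)) (k * expR (k * x)).
  have Hk : is_derive x (1 : R) (fun x => k * x) k.
    by have := is_deriveZ k (is_derive_id x (1 : R)); rewrite /GRing.scale/= mulr1.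
  have := @is_derive1_comp R expR (fun x => k * x) x _ _ (is_derive_expR (k * x)) Hk.
  by rewrite mulrC.
apply: W11_smooth => // x; apply: cvgM; first exact: cvg_cst.
have /derivable1_diffP/differentiable_continuous := @ex_derive _ _ _ _ _ _ _ (D x).
exact.
Qed.

Lemma W11_id L : W11_deriv L (fun x : R => x) (fun=> 1).
Proof. by apply: W11_smooth => // x; exact: cvg_cst. Qed.

Lemma primitive_ext L f g x : {in `[0, L], f =1 g} -> x \in `[0, L] ->
  primitive f x = primitive g x.
Proof.
move=> fg; rewrite in_itv/= => /andP[x0 xL].
apply: eq_Rintegral => y; rewrite inE/= in_itv/= => /andP[y0 yx].
by apply: fg; rewrite in_itv/= y0 (le_trans yx).
Qed.

(** For fixed [x], each branch of the Green function is a combination of 1, s, exp(ks) and exp(-ks),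
    so four primitives suffice for all integrals against it. *)
Lemma primitive_lincomb L k phi (c0 c1 c2 c3 x : R) : inL1 L phi -> x \in `[0, L] ->
  primitive (fun s => (c0 + c1 * s + c2 * expR (k * s) + c3 * expR (- k * s)) * phi s) x =
  c0 * primitive phi x + c1 * primitive (fun s => s * phi s) x +
  c2 * primitive (fun s => expR (k * s) * phi s) x +
  c3 * primitive (fun s => expR (- k * s) * phi s) x.
Proof.
move=> Iphi xL.
have [acE1 _ _] := W11_expR L k; have [acE2 _ _] := W11_expR L (- k).
have [acX _ _] := W11_id L.
have H := W11D (W11D (W11D (W11Z c0 (W11_primitive Iphi))
   (W11Z c1 (W11_primitive (inL1M acX Iphi))))
   (W11Z c2 (W11_primitive (inL1M acE1 Iphi))))
   (W11Z c3 (W11_primitive (inL1M acE2 Iphi))).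
have := W11_FTC H xL; rewrite !primitive0 !mulr0 !add0r => ->.
by apply: primitive_ext xL => y _; ring.
Qed.

Section representation.
Variables (L a : R) (phi : R -> R).
Hypotheses (L0 : 0 < L) (a0 : 0 < a) (Iphi : inL1 L phi).
Let k := Num.sqrt a.
Let Rp := primitive phi.
Let Tp := primitive (fun s => s * phi s).
Let Bp := primitive (fun s => expR (k * s) * phi s).
Let Ap := primitive (fun s => expR (- k * s) * phi s).
Let E := expR (k * L).
Let E' := expR (- k * L).
(** [c1 x] and [c2 (exp(kx) - exp(-kx))] are the integrals over all of [0,L] of the two terms of the
    branch [x <= s] against [phi]. *)
Let c1 := (L * Rp L - Tp L) / (a * L).
Let c2 := (E * Ap L - E' * Bp L) / (2 * a * k * (E - E')).

(* Variation of constants, with greenG x s = g x s + 1_(s <= x) (g s x - g x s)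
   and g s x - g x s = (sinh (k (x - s)) / k - (x - s)) / a. *)
Definition kernel_val x : R :=
  c1 * x - c2 * (expR (k * x) - expR (- k * x))
  + ((expR (k * x) * Ap x - expR (- k * x) * Bp x) / (2 * k) - x * Rp x + Tp x) / a.
Definition kernel_d1 x : R :=
  c1 - c2 * k * (expR (k * x) + expR (- k * x))
  + ((expR (k * x) * Ap x + expR (- k * x) * Bp x) / 2 - Rp x) / a.
Definition kernel_d2 x : R :=
  - c2 * a * (expR (k * x) - expR (- k * x))
  + (expR (k * x) * Ap x - expR (- k * x) * Bp x) * k / 2 / a.
Definition kernel_d3 x : R :=
  - c2 * a * k * (expR (k * x) + expR (- k * x))
  + (expR (k * x) * Ap x + expR (- k * x) * Bp x) / 2.

Let k0 : 0 < k. Proof. by rewrite sqrtr_gt0. Qed.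
Let kk : k * k = a. Proof. by rewrite -expr2 sqr_sqrtr// ltW. Qed.
Let EE : E' < E.
Proof. by rewrite ltr_expR ltr_pM2r//; have := k0; lra. Qed.
Let EV x : expR (- k * x) = (expR (k * x))^-1.
Proof. by rewrite mulNr expRN. Qed.

(** In the first three derivatives the contributions of the differentiated primitives cancel, since
    [exp(kx) Ap'] and [exp(-kx) Bp'] both equal [phi]; in the fourth they leave exactly [phi]. *)
Lemma kernel_beam_solution :
  beam_solution L a phi kernel_val kernel_d1 kernel_d2 kernel_d3.
Proof.
have WE1 := W11_expR L k; have WE2 := W11_expR L (- k); have WX := W11_id L.
have [acE1 _ _] := WE1; have [acE2 _ _] := WE2; have [acX _ _] := WX.
have WR : W11_deriv L Rp _ := W11_primitive Iphi.
have WT : W11_deriv L Tp _ := W11_primitive (inL1M acX Iphi).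
have WB : W11_deriv L Bp _ := W11_primitive (inL1M acE1 Iphi).
have WA : W11_deriv L Ap _ := W11_primitive (inL1M acE2 Iphi).
have kN0 : k != 0 by rewrite gt_eqF.
have aN0 : a != 0 by rewrite gt_eqF.
have LN0 : L != 0 by rewrite gt_eqF.
have EN0 : E - E' != 0 by rewrite subr_eq0 gt_eqF.
have eN0 x : expR (k * x) != 0 by rewrite gt_eqF// expR_gt0.
split; last split.
- split.
  + have H := W11D (W11D (W11Z c1 WX) (W11Z (- c2) (W11B WE1 WE2)))
      (W11Z a^-1 (W11D (W11B (W11Z (2 * k)^-1 (W11B (W11M WE1 WA) (W11M WE2 WB)))
        (W11M WX WR)) WT)).
    apply: W11_eq (W11_ext _ H) => x _; rewrite /kernel_val /kernel_d1 ?EV -?kk; field;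
      rewrite ?kN0 ?eN0 ?aN0//.
  + have H := W11D (W11D (W11_cst L c1) (W11Z (- c2 * k) (W11D WE1 WE2)))
      (W11Z a^-1 (W11B (W11Z 2^-1 (W11D (W11M WE1 WA) (W11M WE2 WB))) WR)).
    apply: W11_eq (W11_ext _ H) => x _; rewrite /kernel_d1 /kernel_d2 ?EV -?kk; field;
      rewrite ?kN0 ?eN0 ?aN0//.
  + have H := W11D (W11Z (- c2 * a) (W11B WE1 WE2))
      (W11Z (k / 2 / a) (W11B (W11M WE1 WA) (W11M WE2 WB))).
    apply: W11_eq (W11_ext _ H) => x _; rewrite /kernel_d2 /kernel_d3 ?EV -?kk; field;
      rewrite ?kN0 ?eN0 ?aN0//.
  + have H := W11D (W11Z (- c2 * a * k) (W11D WE1 WE2))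
      (W11Z 2^-1 (W11D (W11M WE1 WA) (W11M WE2 WB))).
    apply: W11_eq (W11_ext _ H) => x _; rewrite /kernel_d2 /kernel_d3 ?EV -?kk; field;
      rewrite ?kN0 ?eN0 ?aN0//.
- by rewrite /kernel_val /Rp /Tp /Ap /Bp !primitive0 !mulr0 expR0; ring.
- rewrite /kernel_val -/E -/E' /c1 /c2; field.
  by rewrite kN0 aN0 LN0 EN0.
- by rewrite /kernel_d2 /Rp /Tp /Ap /Bp !primitive0 !mulr0 expR0; ring.
- rewrite /kernel_d2 -/E -/E' /c2 -!kk; field.
  by rewrite kN0 EN0.
Qed.

Lemma kernel_valE x : x \in `[0, L] ->
  \int[mu]_(s in `[0, L]) (greenG L a x s * phi s) = kernel_val x.
Proof.
move=> xL; have := xL; rewrite in_itv/= => /andP[x0 x1].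
have kN0 : k != 0 by rewrite gt_eqF.
have aN0 : a != 0 by rewrite gt_eqF.
have LN0 : L != 0 by rewrite gt_eqF.
have EN0 : E - E' != 0 by rewrite subr_eq0 gt_eqF.
have LL : L \in `[0, L] by rewrite in_itv/= lexx ltW.
have [acE1 _ _] := W11_expR L k; have [acE2 _ _] := W11_expR L (- k).
have [acX _ _] := W11_id L.
have Ilc (d0 d1 d2 d3 : R) :
    inL1 L (fun s => (d0 + d1 * s + d2 * expR (k * s) + d3 * expR (- k * s)) * phi s).
  apply: inL1M => //.
  by do ! apply: acD; try apply: acM => //; exact: ac_cst.
pose D := 2 * (a * k * (E - E')).
pose sx := expR (k * x) - expR (- k * x).
(* [up] continues the branch [x <= s] to all of [0,L]; [jump] is the correction for [s <= x]. *)
pose up s := (x / a + - (x / (a * L)) * s + sx * E' / D * expR (k * s)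
   + - sx * E / D * expR (- k * s)) * phi s.
pose jump s := (- (x / a) + a^-1 * s + - expR (- k * x) / (2 * a * k) * expR (k * s)
   + expR (k * x) / (2 * a * k) * expR (- k * s)) * phi s.
have Ij : inL1 L (jump \_ `[0, x]).
  apply: integrableS (integrable_patch (L := x) _) => //.
  apply: integrableS (Ilc _ _ _ _) => // y /=.
  by rewrite !in_itv/= => /andP[-> yx]; exact: le_trans x1.
have eN0 y : expR (k * y) != 0 by rewrite gt_eqF// expR_gt0.
have eD y : expR (k * (L - y)) = E / expR (k * y) by rewrite mulrBr expRD expRN.
have eD' y : expR (- (k * (L - y))) = E' * expR (k * y).
  by rewrite mulrBr opprB addrC -mulNr expRD.
have eE : sinh (k * L) = (E - E') / 2 by rewrite /sinh -mulNr.
have GE : {in `[0, L], (fun s => greenG L a x s * phi s) =1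
    (fun s => up s + (jump \_ `[0, x]) s)}.
  move=> s; rewrite in_itv/= => /andP[s0 sL].
  rewrite patchE; have [sx'|xs] := leP s x.
  - rewrite mem_set/= ?in_itv/= ?s0//.
    have -> : greenG L a x s = s * (L - x) / (a * L)
        - sinh (k * s) * sinh (k * (L - x)) / (a * k * sinh (k * L)).
      rewrite /greenG -/k; case: leP => // xs.
      by have -> : s = x by apply/eqP; rewrite eq_le sx'.
    rewrite eE /sinh eD eD' -!mulNr !EV /up /jump /sx /D !EV; field.
    by rewrite !eN0 EN0 kN0 aN0 LN0.
  - rewrite memNset/= ?in_itv/= ?s0 ?leNgt ?xs// addr0.
    rewrite /greenG -/k (ltW xs) eE /sinh eD eD' -!mulNr !EV /up /sx /D !EV; field.
    by rewrite !eN0 EN0 kN0 aN0 LN0.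
have Iu : inL1 L up by exact: Ilc.
transitivity (primitive up L + primitive jump x).
  have -> : primitive jump x = \int[mu]_(s in `[0, L]) (jump \_ `[0, x]) s.
    rewrite -Rintegral_mkcondr /primitive; congr (Rintegral _ _ _).
    apply/seteqP; split => [y|y []]; rewrite /= !in_itv/= => /andP[y0 yx] //.
    by rewrite y0 yx (le_trans yx).
  rewrite -RintegralD//; apply: eq_Rintegral => s; rewrite inE/= => sL.
  exact: GE.
rewrite !(primitive_lincomb k _ _ _ _ Iphi)// /kernel_val /c1 /c2 /sx /D.
rewrite -/Rp -/Tp -/Ap -/Bp !EV; field.
by rewrite !eN0 EN0 kN0 aN0 LN0.
Qed.

End representation.
End kernel.

(** * The solution with constant source *)

Section zeta.
Context {R : realType}.
Implicit Types (L al be x : R).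
Local Notation mu := (@lebesgue_measure R).

(* Ratios cosh (k (x - L/2)) / cosh (k L / 2) and sinh (k (x - L/2)) / cosh (k L / 2). *)
Definition cosh_ratio L k x : R :=
  (expR (k * x) / expR (k * L / 2) + expR (- k * x) * expR (k * L / 2)) /
  (expR (k * L / 2) + (expR (k * L / 2))^-1).
Definition sinh_ratio L k x : R :=
  (expR (k * x) / expR (k * L / 2) - expR (- k * x) * expR (k * L / 2)) /
  (expR (k * L / 2) + (expR (k * L / 2))^-1).

(* Solves - y'' + al y = 1, y 0 = y L = 0; it is - zeta''. *)
Definition membrane L al x : R := (1 - cosh_ratio L (Num.sqrt al) x) / al.

(** With [zeta'' = - membrane], the equation reads [(al zeta + membrane)'' = -1] with zero end
    values, so this sum is the parabola [x (L - x) / 2]. The bound, the integral and the comparisons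
    in the coefficient all go through this identity. *)
Definition zeta L al x : R := (x * (L - x) / 2 - membrane L al x) / al.
Definition zeta_d1 L al x : R :=
  (L / 2 - x + Num.sqrt al * sinh_ratio L (Num.sqrt al) x / al) / al.
Definition zeta_d3 L al x : R :=
  Num.sqrt al * sinh_ratio L (Num.sqrt al) x / al.

Lemma zetaE L al x : al != 0 -> al * zeta L al x + membrane L al x = x * (L - x) / 2.
Proof. by move=> al0; rewrite /zeta; field. Qed.

Lemma zeta_beam L al : 0 < L -> 0 < al ->
  beam_solution L al (fun=> 1) (zeta L al) (zeta_d1 L al)
    (fun x => - membrane L al x) (zeta_d3 L al).
Proof.
move=> L0 al0; set k := Num.sqrt al.
have k0 : 0 < k by rewrite sqrtr_gt0.
have kk : k * k = al by rewrite -expr2 sqr_sqrtr// ltW.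
have kN0 : k != 0 by rewrite gt_eqF.
set h := expR (k * L / 2).
have h0 : 0 < h by rewrite expR_gt0.
have hN0 : h != 0 by rewrite gt_eqF.
have hh : h * h + 1 != 0 by rewrite gt_eqF//; nra.
have EL : expR (k * L) = h * h by rewrite -expRD; congr expR; field.
have EV x : expR (- k * x) = (expR (k * x))^-1 by rewrite mulNr expRN.
have eN0 x : expR (k * x) != 0 by rewrite gt_eqF// expR_gt0.
have WE1 := W11_expR L k; have WE2 := W11_expR L (- k); have WX := W11_id L.
have WC : W11_deriv L (cosh_ratio L k) (fun x => k * sinh_ratio L k x).
  have H := W11Z (h + h^-1)^-1 (W11D (W11Z h^-1 WE1) (W11Z h WE2)).
  apply: W11_eq (W11_ext _ H) => x _; rewrite /cosh_ratio /sinh_ratio -/h; field;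
  by rewrite hN0 hh.
have WS : W11_deriv L (sinh_ratio L k) (fun x => k * cosh_ratio L k x).
  have H := W11Z (h + h^-1)^-1 (W11B (W11Z h^-1 WE1) (W11Z h WE2)).
  apply: W11_eq (W11_ext _ H) => x _; rewrite /cosh_ratio /sinh_ratio -/h; field;
  by rewrite hN0 hh.
split; last first.
  rewrite /zeta /membrane /cosh_ratio -/k -/h !EV EL mulr0 expR0 -kk; split; field;
  by rewrite ?kN0 ?hN0 ?hh.
split.
- have H := W11Z al^-1 (W11B (W11Z 2^-1 (W11M WX (W11B (W11_cst L L) WX)))
    (W11Z al^-1 (W11B (W11_cst L 1) WC))).
  apply: W11_eq (W11_ext _ H) => x _; rewrite /zeta /zeta_d1 /membrane -/k -?kk; field;
  by rewrite kN0.
- have H := W11Z al^-1 (W11D (W11B (W11_cst L (L / 2)) WX) (W11Z (k / al) WS)).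
  apply: W11_eq (W11_ext _ H) => x _; rewrite /zeta_d1 /membrane -/k -?kk; field;
  by rewrite kN0.
- have H := W11Z (- al^-1) (W11B (W11_cst L 1) WC).
  apply: W11_eq (W11_ext _ H) => x _; rewrite /zeta_d3 /membrane -/k -?kk; field;
  by rewrite kN0.
- have H := W11Z (k / al) WS.
  apply: W11_eq (W11_ext _ H) => x _; rewrite /zeta_d3 /membrane -/k -?kk; field;
  by rewrite kN0.
Qed.

Section bounds.
Variables (L al : R).
Hypotheses (L0 : 0 < L) (al0 : 0 < al).
Let alN0 : al != 0. Proof. by rewrite gt_eqF. Qed.

Lemma zeta_membrane_ge0 x : x \in `[0, L] -> 0 <= zeta L al x /\ 0 <= membrane L al x.
Proof.
move=> xL; have [|H1 H2] := beam_solution_sign (ltW L0) (ltW al0) (zeta_beam L0 al0) _ xL.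
  exact: aeW.
by split => //; lra.
Qed.

Lemma membrane_le x : membrane L al x <= al^-1.
Proof.
rewrite /membrane -[leRHS]mul1r ler_pM2r ?invr_gt0// lerBlDr lerDl /cosh_ratio.
by rewrite divr_ge0// addr_ge0// ?mulr_ge0// ?invr_ge0 expR_ge0.
Qed.

(** [al zeta] lies below the parabola because [membrane >= 0], and the parabola has maximum
    L^2/8. *)
Lemma zeta_le x : x \in `[0, L] -> zeta L al x <= L ^+ 2 / (8 * al).
Proof.
move=> xL; have [_ e0] := zeta_membrane_ge0 xL.
have := zetaE L x alN0 => H.
rewrite ler_pdivlMr ?mulr_gt0// mulrC.
have := sqr_ge0 (x - L / 2); lra.
Qed.

Lemma ac_zeta : abs_continuous L (zeta L al).
Proof. by have [[[]]] := zeta_beam L0 al0. Qed.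

Lemma ac_membrane : abs_continuous L (membrane L al).
Proof.
have [[_ _ [H _ _] _] _] := zeta_beam L0 al0.
by apply: ac_ext (acM (ac_cst L (-1)) H) => x _; ring.
Qed.

(** [membrane] is [- zeta''], so only the end values of [zeta_d1] enter. *)
Lemma int_membrane : \int[mu]_(x in `[0, L]) membrane L al x =
  (L - 2 * tanh (Num.sqrt al * L / 2) / Num.sqrt al) / al.
Proof.
have [[_ H _ _] _] := zeta_beam L0 al0.
have := W11_integral (ltW L0) (W11Z (-1) H).
under eq_Rintegral do rewrite mulN1r opprK.
move=> ->; rewrite /zeta_d1 /sinh_ratio /tanh.
set k := Num.sqrt al; set h := expR (k * L / 2).
have k0 : 0 < k by rewrite sqrtr_gt0.
have kk : k * k = al by rewrite -expr2 sqr_sqrtr// ltW.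
have kN0 : k != 0 by rewrite gt_eqF.
have h0 : 0 < h by rewrite expR_gt0.
have hN0 : h != 0 by rewrite gt_eqF.
have hh : h * h + 1 != 0 by rewrite gt_eqF//; nra.
have EL : expR (k * L) = h * h by rewrite -expRD; congr expR; field.
rewrite expRN !mulNr expRN EL mulr0 oppr0 expR0 -kk -/h; field.
by rewrite kN0 hN0 hh.
Qed.

Lemma int_zeta : \int[mu]_(x in `[0, L]) zeta L al x =
  (L ^+ 3 / 12 - \int[mu]_(x in `[0, L]) membrane L al x) / al.
Proof.
have Iz := inL1_ac ac_zeta; have Ie := inL1_ac ac_membrane.
have WX := W11_id L.
(* The antiderivative L x^2/4 - x^3/6 of the parabola. *)
have H := W11B (W11Z (L / 4) (W11M WX WX)) (W11Z 6^-1 (W11M WX (W11M WX WX))).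
have := W11_integral (ltW L0) H; rewrite !(mulr0, mul0r, subr0) => HI.
have : \int[mu]_(x in `[0, L]) (al * zeta L al x + membrane L al x) = L ^+ 3 / 12.
  rewrite [RHS](_ : _ = L / 4 * (L * L) - 6^-1 * (L * (L * L))); last by field.
  by rewrite -HI; apply: eq_Rintegral => x _; rewrite zetaE//; field.
rewrite RintegralD//; last exact: inL1Z.
by rewrite RintegralZl// => <-; field.
Qed.

End bounds.

(** The difference D of the two functions satisfies [al D - D'' = (be - al) zeta L be >= 0]. *)
Lemma zeta_nonincreasing L al be x : 0 < L -> 0 < al -> al <= be ->
  x \in `[0, L] -> zeta L be x <= zeta L al x.
Proof.
move=> L0 al0 ab xL; have be0 := lt_le_trans al0 ab.
have [[A A1 _ _] [a0 aL _ _]] := zeta_beam L0 al0.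
have [[B B1 _ _] [b0 bL _ _]] := zeta_beam L0 be0.
rewrite -subr_ge0.
apply: (max_principle (ltW L0) (ltW al0) (W11B A B) (W11B A1 B1)) xL.
- by rewrite a0 b0 subrr.
- by rewrite aL bL subrr.
apply: aeW => y; rewrite in_itv/= => /andP[/ltW y0 /ltW yL].
have yI : y \in `[0, L] by rewrite in_itv/= y0.
have := zetaE L y (lt0r_neq0 al0); have := zetaE L y (lt0r_neq0 be0).
have [z0 _] := zeta_membrane_ge0 L0 be0 yI.
have : 0 <= (be - al) * zeta L be y by rewrite mulr_ge0// subr_ge0.
lra.
Qed.

(** With D the difference and [th] the parabola, [(a + b J) D - D'' = (J - I) (th - b I zeta_I)],
    and the last factor equals [a zeta_I + membrane_I >= 0]. *)
Lemma scaled_zeta_nondecreasing L a b (I J : R) x : 0 < L -> 0 < a -> 0 < b ->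
  0 <= I -> I <= J -> x \in `[0, L] ->
  I * zeta L (a + b * I) x <= J * zeta L (a + b * J) x.
Proof.
move=> L0 a0 b0 I0 IJ xL.
have bI : 0 <= b * I by rewrite mulr_ge0// ltW.
have bIJ : b * I <= b * J by rewrite ler_pM2l.
have al0 : 0 < a + b * I by lra.
have be0 : 0 < a + b * J by lra.
have [[A A1 _ _] [za0 zaL _ _]] := zeta_beam L0 al0.
have [[B B1 _ _] [zb0 zbL _ _]] := zeta_beam L0 be0.
rewrite -subr_ge0.
apply: (max_principle (ltW L0) (ltW be0) (W11B (W11Z J B) (W11Z I A))
  (W11B (W11Z J B1) (W11Z I A1))) xL.
- by rewrite za0 zb0 !mulr0 subrr.
- by rewrite zaL zbL !mulr0 subrr.
apply: aeW => y; rewrite in_itv/= => /andP[/ltW y0 /ltW yL].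
have yI : y \in `[0, L] by rewrite in_itv/= y0.
have H1 := zetaE L y (lt0r_neq0 al0); have H2 := zetaE L y (lt0r_neq0 be0).
have [z0 e0] := zeta_membrane_ge0 L0 al0 yI.
set th := y * (L - y) / 2 in H1 H2.
have -> : (a + b * J) * (J * zeta L (a + b * J) y - I * zeta L (a + b * I) y) -
  (J * - membrane L (a + b * J) y - I * - membrane L (a + b * I) y) =
  (J - I) * (th - b * I * zeta L (a + b * I) y).
  rewrite -[in RHS](congr1 (fun t => (J - I) * (t - b * I * zeta L (a + b * I) y)) H1).
  have -> : membrane L (a + b * J) y = th - (a + b * J) * zeta L (a + b * J) y by lra.
  rewrite -H1; ring.
apply: mulr_ge0; first by rewrite subr_ge0.
have : 0 <= a * zeta L (a + b * I) y by rewrite mulr_ge0// ltW.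
lra.
Qed.

Lemma powR_5div2 (a : R) : 0 < a -> a `^ (5 / 2) = a ^+ 2 * Num.sqrt a.
Proof.
move=> a0; have -> : 5 / 2 = 2 + 2^-1 :> R by field.
by rewrite powRD ?(gt_eqF a0) ?implybT// powR_mulrn ?ltW// powR12_sqrt ?ltW.
Qed.

(** The integral of the Green function in [s] is [zeta], so [M] is the denominator in the formula of
    [opS]. *)
Lemma constME L a c : 0 < L -> 0 < a ->
  constM L a c = 1 + c * \int[mu]_(x in `[0, L]) zeta L a x.
Proof.
move=> L0 a0; rewrite int_zeta// int_membrane// /constM.
set k := Num.sqrt a; set t := tanh _.
have kk : k ^+ 2 = a by rewrite sqr_sqrtr// ltW.
have k0 : 0 < k by rewrite sqrtr_gt0.
by rewrite powR_5div2// -/k -kk; field; rewrite gt_eqF.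
Qed.

Lemma constNE L a c : 0 < L -> 0 < a ->
  constN L a c =
  constM L a c + c * (L ^+ 2 / 8) * \int[mu]_(x in `[0, L]) membrane L a x.
Proof.
move=> L0 a0; rewrite int_membrane// /constN /constM.
set k := Num.sqrt a; set t := tanh _.
have kk : k ^+ 2 = a by rewrite sqr_sqrtr// ltW.
have k0 : 0 < k by rewrite sqrtr_gt0.
by rewrite powR_5div2// -/k -kk; field; rewrite gt_eqF.
Qed.

End zeta.

(** * Estimates for the nonlocal linear problem *)

Section normL1.
Context {R : realType}.
Implicit Types (L k : R) (f g h : R -> R).
Local Notation mu := (@lebesgue_measure R).

Lemma normL1_ge0 L f : 0 <= normL1 L f.
Proof. exact: Rintegral_ge0. Qed.

Lemma normL1_le L f g : inL1 L f -> inL1 L g ->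
  {ae mu, forall x, x \in `[0, L] -> `|f x| <= `|g x|} -> normL1 L f <= normL1 L g.
Proof. by move=> If Ig fg; apply: ae_int_le => //; exact: inL1_norm. Qed.

Lemma normL1_ae L f g : inL1 L f -> inL1 L g -> eqL1 L f g ->
  normL1 L f = normL1 L g.
Proof.
move=> If Ig fg; apply/eqP; rewrite eq_le; apply/andP.
by split; apply: normL1_le => //; apply: ae_mp fg => x h /h ->.
Qed.

Lemma normL1Z L k f : inL1 L f -> normL1 L (fun x => k * f x) = `|k| * normL1 L f.
Proof.
move=> If; rewrite /normL1 -RintegralZl//; last exact: inL1_norm.
by apply: eq_Rintegral => x _; rewrite normrM.
Qed.

Lemma normL1D L f g : inL1 L f -> inL1 L g ->
  normL1 L (fun x => f x + g x) <= normL1 L f + normL1 L g.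
Proof.
move=> If Ig; rewrite /normL1 -RintegralD//; try exact: inL1_norm.
apply: le_Rintegral => //; first exact/inL1_norm/inL1D.
  by apply: inL1D; exact: inL1_norm.
by move=> x _; exact: ler_normD.
Qed.

Lemma normL1_distC L f g : normL1 L (fun x => f x - g x) = normL1 L (fun x => g x - f x).
Proof. by apply: eq_Rintegral => x _; rewrite distrC. Qed.

Lemma normL1_triangle L f g h : inL1 L f -> inL1 L g -> inL1 L h ->
  normL1 L (fun x => f x - h x) <=
  normL1 L (fun x => f x - g x) + normL1 L (fun x => g x - h x).
Proof.
move=> If Ig Ih; have := normL1D (inL1B If Ig) (inL1B Ig Ih).
by under [X in normL1 L X <= _ -> _]eq_fun do rewrite subrKA.
Qed.

Lemma le_int_normL1 L f : inL1 L f -> `|\int[mu]_(x in `[0, L]) f x| <= normL1 L f.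
Proof. by move=> If; exact: le_normr_Rintegral. Qed.

Lemma int_norm_mul_le L f g (B : R) : abs_continuous L g -> inL1 L f ->
  {in `[0, L], forall x, g x <= B} ->
  \int[mu]_(x in `[0, L]) (`|f x| * g x) <= B * normL1 L f.
Proof.
move=> acg If gB; rewrite -RintegralZl//; last exact: inL1_norm.
apply: ae_int_le.
- by apply: inL1_ext (inL1M acg (inL1_norm If)) => x _; rewrite mulrC.
- exact/inL1Z/inL1_norm.
- by apply: aeW => x xL; rewrite mulrC ler_wpM2r// gB.
Qed.

End normL1.

Section estimates.
Context {R : realType}.
Variables (L a : R).
Hypotheses (L0 : 0 < L) (a0 : 0 < a).
Implicit Types (f g h p phi v w u : R -> R).
Local Notation mu := (@lebesgue_measure R).

Lemma beam_inL1s al f v v1 v2 v3 : beam_solution L al f v v1 v2 v3 ->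
  inL1 L v /\ inL1 L v2.
Proof. by move=> [[[V _ _] _ [V2 _ _] _] _]; split; exact: inL1_ac. Qed.

Lemma beam_integral f v v1 v2 v3 : beam_solution L a f v v1 v2 v3 ->
  \int[mu]_(x in `[0, L]) v x = \int[mu]_(x in `[0, L]) (f x * zeta L a x).
Proof.
move=> Hv; rewrite (beam_green (ltW L0) Hv (zeta_beam L0 a0)).
by apply: eq_Rintegral => x _; rewrite mulr1.
Qed.

(* |v| and |v''| are dominated by the solution with source |f|, whose integrals
   Green's identity reads off from zeta. *)
Lemma beam_bounds f v v1 v2 v3 : beam_solution L a f v v1 v2 v3 ->
  normL1 L v <= L ^+ 2 / (8 * a) * normL1 L f /\ normL1 L v2 <= a^-1 * normL1 L f.
Proof.
move=> Hv; have If := beam_inL1 Hv; have If' := inL1_norm If.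
have HV := kernel_beam_solution L0 a0 If'.
set V := kernel_val _ _ _ in HV; set V2 := kernel_d2 _ _ _ in HV.
have dom x : x \in `[0, L] -> `|v x| <= V x /\ `|v2 x| <= - V2 x.
  move=> xL.
  (* [V + v] and [V - v] have the nonnegative sources [|f| + f] and [|f| - f]. *)
  have Hp := beam_solution_lincomb 1 HV Hv; have Hm := beam_solution_lincomb (-1) HV Hv.
  have [|p1 p2] := beam_solution_sign (ltW L0) (ltW a0) Hp _ xL.
    by apply: aeW => y _; have /ler_normlP[] := lexx `|f y|; lra.
  have [|m1 m2] := beam_solution_sign (ltW L0) (ltW a0) Hm _ xL.
    by apply: aeW => y _; have /ler_normlP[] := lexx `|f y|; lra.
  by split; apply/ler_normlP; split; lra.
have [Iv Iv2] := beam_inL1s Hv; have [IV IV2] := beam_inL1s HV.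
have HZ := zeta_beam L0 a0.
split.
- apply: le_trans (int_norm_mul_le (ac_zeta L0 a0) If (zeta_le L0 a0)).
  rewrite -(beam_integral HV); apply: ae_int_le => //; first exact: inL1_norm.
  by apply: aeW => x /dom[].
- apply: le_trans (int_norm_mul_le (ac_membrane L0 a0) If (fun x _ => membrane_le _ a0 x)).
  have -> : \int[mu]_(x in `[0, L]) (`|f x| * membrane L a x) =
      \int[mu]_(x in `[0, L]) (- V2 x).
    have := beam_green2 (ltW L0) HV HZ.
    move=> /(congr1 (fun t => -1 * t)); rewrite -!RintegralZl//.
    + move=> H; transitivity (\int[mu]_(x in `[0, L]) (-1 * (`|f x| * - membrane L a x))).
        by apply: eq_Rintegral => x _; ring.
      by rewrite H; apply: eq_Rintegral => x _; ring.
    + by apply: inL1_ext IV2 => x _; rewrite mulr1.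
    + by apply: inL1_ext (inL1Z (-1) (inL1M (ac_membrane L0 a0) If')) => x _; ring.
  apply: ae_int_le; [exact: inL1_norm|exact: inL1N|].
  by apply: aeW => x /dom[].
Qed.

Section nonlocal.
Variable c : R.
Hypothesis c0 : 0 < c.
Let M := constM L a c.
Let N := constN L a c.

(* w'''' - a w'' + c int w = f with hinged ends. *)
Definition nonlocal_solution f w w1 w2 w3 : Prop :=
  beam_solution L a (fun x => f x - c * \int[mu]_(t in `[0, L]) w t) w w1 w2 w3.

(** With [k = -1] this turns bounds on one solution into Lipschitz bounds. *)
Lemma nonlocal_lincomb k f g w w1 w2 w3 u u1 u2 u3 :
  nonlocal_solution f w w1 w2 w3 -> nonlocal_solution g u u1 u2 u3 ->
  nonlocal_solution (fun x => f x + k * g x)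
    (fun x => w x + k * u x) (fun x => w1 x + k * u1 x)
    (fun x => w2 x + k * u2 x) (fun x => w3 x + k * u3 x).
Proof.
move=> Hw Hu; have [Iw _] := beam_inL1s Hw; have [Iu _] := beam_inL1s Hu.
have H := beam_solution_lincomb k Hw Hu.
apply: beam_solution_source H; last first.
  by apply: aeW => x _; rewrite RintegralD ?RintegralZl//; [ring|exact: inL1Z].
apply: inL1_ext (inL1D (beam_inL1 Hw) (inL1Z k (beam_inL1 Hu))) => x _.
by rewrite RintegralD ?RintegralZl//; [ring|exact: inL1Z].
Qed.

Lemma nonlocal_inL1 f w w1 w2 w3 : nonlocal_solution f w w1 w2 w3 -> inL1 L f.
Proof.
move=> /beam_inL1 H.
by apply: inL1_ext (inL1D H (inL1_cst L (c * \int[mu]_(t in `[0, L]) w t))) => x _; ring.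
Qed.

Lemma int_zeta_ge0 : 0 <= \int[mu]_(x in `[0, L]) zeta L a x.
Proof.
apply: ae_int_ge0; first exact/inL1_ac/ac_zeta.
by apply: aeW => x xL; have [] := zeta_membrane_ge0 L0 a0 xL.
Qed.

Lemma int_membrane_ge0 : 0 <= \int[mu]_(x in `[0, L]) membrane L a x.
Proof.
apply: ae_int_ge0; first exact/inL1_ac/ac_membrane.
by apply: aeW => x xL; have [] := zeta_membrane_ge0 L0 a0 xL.
Qed.

Lemma constM_ge1 : 1 <= M.
Proof. by rewrite /M constME// lerDl mulr_ge0// ?int_zeta_ge0// ltW. Qed.

Lemma constN_geM : M <= N.
Proof.
rewrite /N constNE// lerDl mulr_ge0// ?int_membrane_ge0//.
by rewrite mulr_ge0// ?ltW// divr_gt0// exprn_gt0.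
Qed.

(** The integral term is a constant source [- c I], which adding [c I zeta] cancels. *)
Lemma nonlocal_beam f w w1 w2 w3 (I := \int[mu]_(t in `[0, L]) w t) :
  nonlocal_solution f w w1 w2 w3 ->
  beam_solution L a f (fun x => w x + c * I * zeta L a x)
    (fun x => w1 x + c * I * zeta_d1 L a x)
    (fun x => w2 x + c * I * - membrane L a x)
    (fun x => w3 x + c * I * zeta_d3 L a x).
Proof.
move=> Hw; have If := nonlocal_inL1 Hw.
apply: beam_solution_source (beam_solution_lincomb (c * I) Hw (zeta_beam L0 a0)) => //.
by apply: aeW => x _; rewrite -/I; ring.
Qed.

Lemma nonlocal_integral f w w1 w2 w3 : nonlocal_solution f w w1 w2 w3 ->
  \int[mu]_(x in `[0, L]) w x * M = \int[mu]_(x in `[0, L]) (f x * zeta L a x).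
Proof.
move=> Hw; have [Iw _] := beam_inL1s Hw.
rewrite -(beam_integral (nonlocal_beam Hw)) RintegralD ?RintegralZl//.
- by rewrite /M constME//; ring.
- exact/inL1_ac/ac_zeta.
- exact/inL1Z/inL1_ac/ac_zeta.
Qed.

Lemma nonlocal_integral_bound f w w1 w2 w3 : nonlocal_solution f w w1 w2 w3 ->
  `|\int[mu]_(x in `[0, L]) w x| <= L ^+ 2 / (8 * a * M) * normL1 L f.
Proof.
move=> Hw; have If := nonlocal_inL1 Hw.
have M0 : 0 < M by apply: lt_le_trans constM_ge1.
have If2 : inL1 L (fun x => f x * zeta L a x).
  by apply: inL1_ext (inL1M (ac_zeta L0 a0) If) => x _; rewrite mulrC.
rewrite -[_ * normL1 L f](mulfK (lt0r_neq0 M0)) ler_pdivlMr//.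
rewrite -[X in _ * X <= _](gtr0_norm M0) -normrM (nonlocal_integral Hw).
have -> : L ^+ 2 / (8 * a * M) * normL1 L f * M = L ^+ 2 / (8 * a) * normL1 L f.
  by field; rewrite !gt_eqF.
apply: le_trans (le_int_normL1 If2) _.
apply: le_trans _ (int_norm_mul_le (ac_zeta L0 a0) If (zeta_le L0 a0)).
rewrite le_eqVlt; apply/orP; left; apply/eqP; apply: eq_Rintegral => x.
rewrite inE/= => xL; have [z0 _] := zeta_membrane_ge0 L0 a0 xL.
by rewrite normrM (ger0_norm z0).
Qed.

(** Removing [c I zeta] leaves a function with second derivative of norm at most [|f|_1 / a];
    putting it back costs [c |I|] times the integral of [membrane]. By [constNE] the sum is exactly
    N/(aM). *)
Lemma nonlocal_d2_bound f w w1 w2 w3 : nonlocal_solution f w w1 w2 w3 ->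
  normL1 L w2 <= N / (a * M) * normL1 L f.
Proof.
move=> Hw; have [Iw Iw2] := beam_inL1s Hw.
have M0 : 0 < M by apply: lt_le_trans constM_ge1.
set I := \int[mu]_(x in `[0, L]) w x.
have [_ B2] := beam_bounds (nonlocal_beam Hw).
have Ib : `|I| <= _ := nonlocal_integral_bound Hw.
have Ie := inL1_ac (ac_membrane L0 a0); have E0 := int_membrane_ge0.
have : normL1 L w2 <= normL1 L (fun x => w2 x + c * I * - membrane L a x)
    + c * `|I| * \int[mu]_(x in `[0, L]) membrane L a x.
  have -> : c * `|I| * \int[mu]_(x in `[0, L]) membrane L a x =
      normL1 L (fun x => c * I * membrane L a x).
    rewrite normL1Z// normrM (gtr0_norm c0); congr (_ * _).
    apply: eq_Rintegral => x; rewrite inE/= => xL.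
    by have [_ ?] := zeta_membrane_ge0 L0 a0 xL; rewrite ger0_norm.
  apply: le_trans (normL1D _ _); last 2 first.
  - by apply: inL1D => //; apply/inL1Z/inL1N.
  - exact: inL1Z.
  rewrite le_eqVlt; apply/orP; left; apply/eqP; congr (normL1 L _).
  by apply/funext => x; ring.
have -> : N / (a * M) * normL1 L f = a^-1 * normL1 L f +
   c * (L ^+ 2 / (8 * a * M) * normL1 L f) * \int[mu]_(x in `[0, L]) membrane L a x.
  by rewrite /N constNE// -/M; field; rewrite !gt_eqF.
move=> H; apply: (le_trans H); apply: lerD => //.
by rewrite ler_wpM2r// ler_wpM2l// ltW.
Qed.

(** Same splitting for [w] itself; the factor is L^2/(8a) times 1 + (M - 1)/M, which is [K]. *)
Lemma nonlocal_bound f w w1 w2 w3 : nonlocal_solution f w w1 w2 w3 ->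
  normL1 L w <= constK L a c * normL1 L f.
Proof.
move=> Hw; have [Iw Iw2] := beam_inL1s Hw.
have M0 : 0 < M by apply: lt_le_trans constM_ge1.
set I := \int[mu]_(x in `[0, L]) w x.
have [B1 _] := beam_bounds (nonlocal_beam Hw).
have Ib : `|I| <= _ := nonlocal_integral_bound Hw.
have Iz := inL1_ac (ac_zeta L0 a0); have Z0 := int_zeta_ge0.
have : normL1 L w <= normL1 L (fun x => w x + c * I * zeta L a x)
    + c * `|I| * \int[mu]_(x in `[0, L]) zeta L a x.
  have -> : c * `|I| * \int[mu]_(x in `[0, L]) zeta L a x =
      normL1 L (fun x => - (c * I) * zeta L a x).
    rewrite normL1Z// normrN normrM (gtr0_norm c0); congr (_ * _).
    apply: eq_Rintegral => x; rewrite inE/= => xL.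
    by have [? _] := zeta_membrane_ge0 L0 a0 xL; rewrite ger0_norm.
  apply: le_trans (normL1D _ _); last 2 first.
  - by apply: inL1D => //; exact: inL1Z.
  - exact: inL1Z.
  rewrite le_eqVlt; apply/orP; left; apply/eqP; congr (normL1 L _).
  by apply/funext => x; ring.
have -> : constK L a c * normL1 L f = L ^+ 2 / (8 * a) * normL1 L f +
   c * (L ^+ 2 / (8 * a * M) * normL1 L f) * \int[mu]_(x in `[0, L]) zeta L a x.
  have -> : \int[mu]_(x in `[0, L]) zeta L a x = (M - 1) / c.
    by rewrite /M constME// addrC addKr mulrC mulKf// gt_eqF.
  by rewrite /constK -/M; field; rewrite !gt_eqF.
move=> H; apply: (le_trans H); apply: lerD => //.
by rewrite ler_wpM2r// ler_wpM2l// ltW.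
Qed.

Lemma beam_solution_ext al f v v' v1 v2 v3 : {in `[0, L], v =1 v'} ->
  beam_solution L al f v v1 v2 v3 -> beam_solution L al f v' v1 v2 v3.
Proof.
move=> vv' [[V V1 V2 V3] [v0 vL v20 v2L]]; split.
  by split => //; exact: W11_ext V.
by rewrite -!vv' ?in_itv/= ?lexx ?(ltW L0).
Qed.

(** With [V] the Green potential of [phi] and [m] its integral, [opS] is [V - (c m / M) zeta]. Its
    integral is [m / M], so the constant source carried by the [zeta] term is the required one. *)
Lemma opS_nonlocal phi : inL1 L phi -> exists w1 w2 w3,
  nonlocal_solution phi (opS L a c phi) w1 w2 w3.
Proof.
move=> Iphi; have M0 : 0 < M by apply: lt_le_trans constM_ge1.
have HV := kernel_beam_solution L0 a0 Iphi; have HZ := zeta_beam L0 a0.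
have G1E : {in `[0, L], forall x, \int[mu]_(s in `[0, L]) greenG L a x s = zeta L a x}.
  move=> x xL; have H1 := kernel_beam_solution L0 a0 (inL1_cst L 1).
  transitivity (\int[mu]_(s in `[0, L]) (greenG L a x s * 1)).
    by apply: eq_Rintegral => s _; rewrite mulr1.
  rewrite (kernel_valE L0 a0 (inL1_cst L 1) xL).
  by have [] := beam_solution_unique (ltW L0) (ltW a0) H1 HZ (aeW _ (fun x _ => erefl)) xL.
pose V := kernel_val L a phi; pose m := \int[mu]_(x in `[0, L]) V x.
have [IV _] := beam_inL1s HV; have Iz := inL1_ac (ac_zeta L0 a0).
have SE : {in `[0, L], (fun x => V x + - (c * m / M) * zeta L a x) =1 opS L a c phi}.
  move=> x xL; rewrite /opS (kernel_valE L0 a0 Iphi xL) (G1E _ xL).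
  have -> : \int[mu]_(t in `[0, L]) \int[mu]_(s in `[0, L]) greenG L a t s =
      \int[mu]_(t in `[0, L]) zeta L a t.
    by apply: eq_Rintegral => t; rewrite inE/= => /G1E.
  have -> : \int[mu]_(t in `[0, L]) \int[mu]_(s in `[0, L]) (greenG L a t s * phi s) = m.
    by apply: eq_Rintegral => t; rewrite inE/= => tL; exact: kernel_valE.
  by rewrite -constME// -/M -/V; field; rewrite gt_eqF.
have IS : \int[mu]_(x in `[0, L]) opS L a c phi x = m / M.
  transitivity (\int[mu]_(x in `[0, L]) (V x + - (c * m / M) * zeta L a x)).
    by apply: eq_Rintegral => x; rewrite inE/= => xL; rewrite SE.
  rewrite RintegralD ?RintegralZl//; last exact: inL1Z.
  have -> : \int[mu]_(x in `[0, L]) zeta L a x = (M - 1) / c.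
    by rewrite /M constME// addrC addKr mulrC mulKf// gt_eqF.
  by rewrite -/m; field; rewrite !gt_eqF.
do 3 eexists; rewrite /nonlocal_solution IS.
apply: (beam_solution_ext SE).
apply: beam_solution_source (beam_solution_lincomb (- (c * m / M)) HV HZ).
  by apply: inL1B => //; exact: inL1_cst.
by apply: aeW => x _; field; rewrite gt_eqF.
Qed.

End nonlocal.

Lemma beam_derive2 al f v v1 v2 v3 : beam_solution L al f v v1 v2 v3 ->
  {in `]0, L[, (v^`(2))%classic =1 v2}.
Proof.
move=> [[V V1 V2 V3] _] x xL.
have [ac1 _ _] := V1; have [ac2 _ _] := V2.
have d1 y : y \in `]0, L[ -> (v^`())%classic y = v1 y.
  by move=> yL; rewrite derive1E; have H := W11_is_derive V ac1 yL; exact: derive_val.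
rewrite derive1nS derive1n1 derive1E.
have nx : \near x, (v^`())%classic x = v1 x.
  have : nbhs x `]0, L[%classic by apply: open_nbhs_nbhs; split => //; exact: interval_open.
  by apply: filterS => y /d1.
rewrite (near_eq_derive _ nx).
by have H := W11_is_derive V1 ac2 xL; exact: derive_val.
Qed.

End estimates.

(** * Contraction and uniqueness *)

Section contraction.
Context {R : realType}.
Variables (L a b c : R) (p : R -> R).
Hypotheses (L0 : 0 < L) (a0 : 0 < a) (b0 : 0 < b) (c0 : 0 < c) (Ip : inL1 L p).
Implicit Types (f g phi psi : R -> R).
Local Notation mu := (@lebesgue_measure R).
Let M := constM L a c.
Let N := constN L a c.
Let q := constq L a b c p.
Let M0 : 0 < M. Proof. by apply: lt_le_trans (constM_ge1 L0 a0 c0). Qed.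
Let N0 : 0 < N. Proof. exact: lt_le_trans M0 (constN_geM L0 a0 c0). Qed.

Lemma constq_ge0 : 0 <= q.
Proof.
rewrite /q /constq -/M -/N mulr_ge0 ?normL1_ge0// divr_ge0//.
  by rewrite !mulr_ge0 ?ltW// exprn_gt0.
by rewrite !mulr_ge0 ?exprn_ge0// ltW.
Qed.

Lemma constq_lt1 : normL1 L p < 2 * a ^+ 2 * M ^+ 2 / (b * L ^+ 2 * N) -> q < 1.
Proof.
rewrite ltr_pdivlMr; last by rewrite !mulr_gt0// exprn_gt0.
by rewrite /q /constq -/M -/N mulrA ltr_pdivrMr ?mul1r// !mulr_gt0// exprn_gt0.
Qed.

Lemma constK_ge0 : 0 <= constK L a c.
Proof.
have M1 : 1 <= M := constM_ge1 L0 a0 c0.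
rewrite /constK -/M mulr_ge0// divr_ge0// ?exprn_ge0 ?mulr_ge0 ?ltW//.
by have := ltW M0; lra.
Qed.

Lemma opA_eq phi w1 w2 w3 : nonlocal_solution L a c phi (opS L a c phi) w1 w2 w3 ->
  eqL1 L (opA L a b c p phi)
    (fun x => p x + b * (\int[mu]_(t in `[0, L]) opS L a c phi t) * w2 x).
Proof.
move=> Hw; apply: ae_itv; apply: aeW => x xL.
by rewrite /opA (beam_derive2 Hw).
Qed.

(** The product difference splits as [I (w2 - u2) + (I - J) u2], and each half contributes [q / 2].
    [A] and [B] are arbitrary integrable representatives, as the iterates are given only up to null
    sets. *)
Lemma opA_contraction phi psi (A B : R -> R) :
  in_ballL1 L (2 * normL1 L p) phi -> in_ballL1 L (2 * normL1 L p) psi ->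
  inL1 L A -> inL1 L B ->
  eqL1 L A (opA L a b c p phi) -> eqL1 L B (opA L a b c p psi) ->
  normL1 L (fun x => A x - B x) <= q * normL1 L (fun x => phi x - psi x).
Proof.
move=> [Iphi Bphi] [Ipsi Bpsi] IA IB Aphi Bpsi'.
have [w1 [w2 [w3 Hw]]] := opS_nonlocal L0 a0 c0 Iphi.
have [u1 [u2 [u3 Hu]]] := opS_nonlocal L0 a0 c0 Ipsi.
have [Iw Iw2] := beam_inL1s Hw; have [Iu Iu2] := beam_inL1s Hu.
set I := \int[mu]_(t in `[0, L]) opS L a c phi t.
set J := \int[mu]_(t in `[0, L]) opS L a c psi t.
have Hd := nonlocal_lincomb (-1) Hw Hu.
set dphi := normL1 L (fun x => phi x - psi x).
have dE : normL1 L (fun x => phi x + -1 * psi x) = dphi.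
  by congr (normL1 L _); apply/funext => x; ring.
have Id : `|I - J| <= L ^+ 2 / (8 * a * M) * dphi.
  have := nonlocal_integral_bound L0 a0 c0 Hd; rewrite dE -/M.
  rewrite RintegralD// ?RintegralZl// -/I -/J ?mulN1r//; exact: inL1Z.
have I2d : normL1 L (fun x => w2 x - u2 x) <= N / (a * M) * dphi.
  have := nonlocal_d2_bound L0 a0 c0 Hd; rewrite dE -/M -/N.
  by under [X in normL1 L X <= _ -> _]eq_fun do rewrite mulN1r.
have Ib : `|I| <= _ := nonlocal_integral_bound L0 a0 c0 Hw.
have u2b := nonlocal_d2_bound L0 a0 c0 Hu.
rewrite -/M in Ib u2b; rewrite -/N in u2b.
have -> : normL1 L (fun x => A x - B x) =
    normL1 L (fun x => b * I * (w2 x - u2 x) + b * (I - J) * u2 x).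
  apply: normL1_ae; first exact: inL1B.
    by apply: inL1D; apply: inL1Z => //; exact: inL1B.
  apply: ae_mp2 (ae_mp2 (fun x => @conj _ _) Aphi Bpsi')
    (ae_mp2 (fun x => @conj _ _) (opA_eq Hw) (opA_eq Hu)) => x [h1 h2] [h3 h4] xL.
  by rewrite h1// h2// h3// h4// -/I -/J; ring.
apply: (le_trans (normL1D _ _)).
- by apply: inL1Z; exact: inL1B.
- exact: inL1Z.
rewrite !normL1Z//; last exact: inL1B.
rewrite !normrM (gtr0_norm b0).
set P := normL1 L p in Bphi Bpsi *; have P0 : 0 <= P by exact: normL1_ge0.
have d0 : 0 <= dphi by exact: normL1_ge0.
set c1 := L ^+ 2 / (8 * a * M) in Ib Id; set c2 := N / (a * M) in I2d u2b.
have c10 : 0 <= c1 by rewrite divr_ge0 ?exprn_ge0 ?mulr_ge0// ltW.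
have c20 : 0 <= c2 by rewrite divr_ge0 ?mulr_ge0// ltW.
have -> : q * dphi = b * (c1 * (2 * P)) * (c2 * dphi) + b * (c1 * dphi) * (c2 * (2 * P)).
  by rewrite /q /constq -/P -/M -/N /c1 /c2; field; rewrite !gt_eqF.
apply: lerD; apply: ler_pM; rewrite ?mulr_ge0 ?normL1_ge0 ?(ltW b0)//.
- by rewrite ler_wpM2l ?(ltW b0)// (le_trans Ib)// ler_wpM2l.
- by rewrite ler_wpM2l ?(ltW b0).
- by rewrite (le_trans u2b)// ler_wpM2l.
Qed.

(** On the ball the quadratic term has norm at most [q |p|_1], so radius [2 |p|_1] is kept as soon
    as [q <= 1]. *)
Lemma opA_ball phi A : q <= 1 ->
  in_ballL1 L (2 * normL1 L p) phi -> inL1 L A -> eqL1 L A (opA L a b c p phi) ->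
  in_ballL1 L (2 * normL1 L p) A.
Proof.
move=> q1 [Iphi Bphi] IA Aphi; split => //.
have [w1 [w2 [w3 Hw]]] := opS_nonlocal L0 a0 c0 Iphi.
have [Iw Iw2] := beam_inL1s Hw.
set I := \int[mu]_(t in `[0, L]) opS L a c phi t.
have Ib : `|I| <= _ := nonlocal_integral_bound L0 a0 c0 Hw.
have w2b := nonlocal_d2_bound L0 a0 c0 Hw.
rewrite -/M in Ib w2b; rewrite -/N in w2b.
have -> : normL1 L A = normL1 L (fun x => p x + b * I * w2 x).
  apply: normL1_ae => //; first by apply: inL1D => //; exact: inL1Z.
  by apply: ae_mp2 Aphi (opA_eq Hw) => x h1 h2 xL; rewrite h1// h2.
apply: (le_trans (normL1D _ _)) => //; first exact: inL1Z.
rewrite normL1Z// normrM (gtr0_norm b0).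
set P := normL1 L p in Bphi *; have P0 : 0 <= P by exact: normL1_ge0.
set c1 := L ^+ 2 / (8 * a * M) in Ib; set c2 := N / (a * M) in w2b.
have c10 : 0 <= c1 by rewrite divr_ge0 ?exprn_ge0 ?mulr_ge0// ltW.
have c20 : 0 <= c2 by rewrite divr_ge0 ?mulr_ge0// ltW.
have : b * `|I| * normL1 L w2 <= b * (c1 * (2 * P)) * (c2 * (2 * P)).
  apply: ler_pM; rewrite ?mulr_ge0 ?normL1_ge0 ?(ltW b0)//.
    by rewrite ler_wpM2l ?(ltW b0)// (le_trans Ib)// ler_wpM2l.
  by rewrite (le_trans w2b)// ler_wpM2l.
have -> : b * (c1 * (2 * P)) * (c2 * (2 * P)) = q * P.
  by rewrite /q /constq -/P -/M -/N /c1 /c2; field; rewrite !gt_eqF.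
have : q * P <= P by rewrite ler_piMl.
lra.
Qed.

(** Freezing the integral [I] turns the nonlinear problem into a linear one with constant
    coefficient. *)
Lemma bvp_beam u (I := \int[mu]_(t in `[0, L]) u t) : bvp_solution L a b c p u ->
  exists u1 u2 u3, beam_solution L (a + b * I) (fun x => p x - c * I) u u1 u2 u3.
Proof.
move=> [u1 [u2 [u3 [u4 [[U U1 U2 U3] eq4 [u0 uL] [u20 u2L]]]]]].
exists u1, u2, u3; split => //; split => //.
have [ac2 _ _] := U2.
apply: W11_ae U3.
  by apply: inL1D; [apply: inL1B => //; exact: inL1_cst|exact/inL1Z/inL1_ac].
apply: ae_mp eq4 => x h xL.
have : x \in `[0, L] by move: xL; rewrite !in_itv/= => /andP[/ltW -> /ltW ->].
by move=> /h; rewrite -/I; lra.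
Qed.

(* Green's identity with zeta for the coefficient a + b I: a scalar equation for I. *)
Lemma bvp_integral u (I := \int[mu]_(t in `[0, L]) u t) :
  bvp_solution L a b c p u -> 0 < a + b * I ->
  I + c * \int[mu]_(x in `[0, L]) (I * zeta L (a + b * I) x) =
  \int[mu]_(x in `[0, L]) (p x * zeta L (a + b * I) x).
Proof.
move=> /bvp_beam[u1 [u2 [u3]]]; rewrite -/I => Hu al0.
have := beam_integral L0 al0 Hu; rewrite -/I => {1}->.
have acz := ac_zeta L0 al0; have Iz := inL1_ac acz.
rewrite -RintegralZl//; last exact: inL1Z.
rewrite -RintegralD//.
- by apply: eq_Rintegral => x _; ring.
- apply: inL1_ext (inL1M acz (beam_inL1 Hu)) => x _; exact: mulrC.
- exact/inL1Z/inL1Z.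
Qed.

Lemma bvp_unique u w : {ae mu, forall x, x \in `[0, L] -> 0 <= p x} ->
  bvp_solution L a b c p u -> bvp_solution L a b c p w ->
  0 <= \int[mu]_(t in `[0, L]) u t -> 0 <= \int[mu]_(t in `[0, L]) w t ->
  {in `[0, L], u =1 w}.
Proof.
move=> p0.
wlog IJ : u w / \int[mu]_(t in `[0, L]) u t <= \int[mu]_(t in `[0, L]) w t.
  move=> H Hu Hw I0 J0.
  have [|/ltW] := leP (\int[mu]_(t in `[0, L]) u t) (\int[mu]_(t in `[0, L]) w t).
    by move=> /H; apply.
  by move=> /H /(_ Hw Hu J0 I0) E x /E.
move=> Hu Hw I0 J0.
set I := \int[mu]_(t in `[0, L]) u t in IJ I0; set J := \int[mu]_(t in `[0, L]) w t in IJ J0.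
have bI0 : 0 <= b * I by rewrite mulr_ge0// ltW.
have bIJ : b * I <= b * J by rewrite ler_pM2l.
have al0 : 0 < a + b * I by exact: ltr_pwDl.
have be0 : 0 < a + b * J by rewrite (lt_le_trans al0)// lerD2l.
have EI := bvp_integral Hu al0; have EJ := bvp_integral Hw be0.
rewrite -/I in EI; rewrite -/J in EJ.
have aca := ac_zeta L0 al0; have acb := ac_zeta L0 be0.
have Ipz g : abs_continuous L g -> inL1 L (fun x => p x * g x).
  by move=> acg; apply: inL1_ext (inL1M acg Ip) => x _; exact: mulrC.
have le1 : \int[mu]_(x in `[0, L]) (p x * zeta L (a + b * J) x) <=
           \int[mu]_(x in `[0, L]) (p x * zeta L (a + b * I) x).
  apply: ae_int_le; [exact: Ipz|exact: Ipz|].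
  apply: ae_mp p0 => x h xL; rewrite ler_wpM2l ?h//.
  by apply: zeta_nonincreasing => //; lra.
have le2 : \int[mu]_(x in `[0, L]) (I * zeta L (a + b * I) x) <=
           \int[mu]_(x in `[0, L]) (J * zeta L (a + b * J) x).
  apply: ae_int_le; [exact/inL1Z/inL1_ac|exact/inL1Z/inL1_ac|].
  by apply: aeW => x xL; exact: scaled_zeta_nondecreasing.
have le3 := ler_wpM2l (ltW c0) le2.
(* By [EJ], [le1], [EI] and [le3]: J + c int(J zeta_J) = int(p zeta_J) <= int(p zeta_I) = I + c
   int(I zeta_I) <= I + c int(J zeta_J), so J <= I. *)
have IJE : I = J by lra.
have [u1 [u2 [u3 Hu']]] := bvp_beam Hu; have [w1 [w2 [w3 Hw']]] := bvp_beam Hw.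
rewrite -/I IJE in Hu'; rewrite -/J in Hw'.
move=> x xL.
by have [] := beam_solution_unique (ltW L0) (ltW be0) Hu' Hw' (aeW _ (fun x _ => erefl)) xL.
Qed.

Lemma fixed_point_bvp phi : inL1 L phi -> eqL1 L (opA L a b c p phi) phi ->
  bvp_solution L a b c p (opS L a c phi).
Proof.
move=> Iphi fix_phi.
have [w1 [w2 [w3 Hw]]] := opS_nonlocal L0 a0 c0 Iphi.
have [W bc] := Hw; have [v0 vL v20 v2L] := bc.
rewrite /bvp_solution; set I := \int[mu]_(t in `[0, L]) _ in W *.
exists w1, w2, w3, (fun x => phi x - c * I + a * w2 x); split => //.
apply: ae_mp2 fix_phi (opA_eq Hw) => x h1 h2 xL.
by rewrite -(h1 xL) (h2 xL) -/I; ring.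
Qed.

(** Even for [p >= 0] the source [phi] may change sign, so positivity of the Green function does not
    settle the sign of [I]. Once [a + b I > 0], the scalar equation gives [I (1 + c int zeta_I) =
    int (p zeta_I) >= 0]. *)
Lemma fixed_point_integral_ge0 phi : q < 1 ->
  in_ballL1 L (2 * normL1 L p) phi -> eqL1 L (opA L a b c p phi) phi ->
  {ae mu, forall x, x \in `[0, L] -> 0 <= p x} ->
  0 <= \int[mu]_(t in `[0, L]) opS L a c phi t.
Proof.
move=> q1 [Iphi Bphi] fix_phi p0.
have [w1 [w2 [w3 Hw]]] := opS_nonlocal L0 a0 c0 Iphi.
set I := \int[mu]_(t in `[0, L]) _.
have Ib : `|I| <= _ := nonlocal_integral_bound L0 a0 c0 Hw.
rewrite -/M in Ib.
have MN : M <= N := constN_geM L0 a0 c0.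
have al0 : 0 < a + b * I.
  set P := normL1 L p in Bphi; have P0 : 0 <= P by exact: normL1_ge0.
  have h1 : b * `|I| <= b * (L ^+ 2 / (8 * a * M) * (2 * P)).
    rewrite ler_wpM2l ?(ltW b0)// (le_trans Ib)// ler_wpM2l//.
    by rewrite divr_ge0 ?exprn_ge0 ?mulr_ge0// ltW.
  (* The ball bound on [b |I|] is [q a / 2] reduced by [M / N <= 1], hence below [a]. *)
  have h2 : b * (L ^+ 2 / (8 * a * M) * (2 * P)) = q * a / 2 * (M / N).
    by rewrite /q /constq -/P -/M -/N; field; rewrite !gt_eqF.
  have h3 : q * a / 2 * (M / N) <= q * a / 2.
    have qa : 0 <= q * a / 2.
      by rewrite divr_ge0// mulr_ge0 ?(ltW a0)//; exact: constq_ge0.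
    have MN1 : M / N <= 1 by rewrite ler_pdivrMr// mul1r.
    by rewrite -[leRHS]mulr1 ler_wpM2l.
  have h4 : q * a < a by rewrite gtr_pMl.
  have h5 : - (b * `|I|) <= b * I.
    by rewrite -mulrN ler_wpM2l ?(ltW b0)// lerNl -normrN ler_norm.
  have h6 : 0 <= b * `|I| by rewrite mulr_ge0// ltW.
  lra.
have := bvp_integral (fixed_point_bvp Iphi fix_phi) al0; rewrite -/I.
have acz := ac_zeta L0 al0.
have z0 x : x \in `[0, L] -> 0 <= zeta L (a + b * I) x.
  by move=> xL; have [] := zeta_membrane_ge0 L0 al0 xL.
have Z0 : 0 <= \int[mu]_(x in `[0, L]) zeta L (a + b * I) x.
  by apply: ae_int_ge0; [exact: inL1_ac|exact: aeW].
rewrite RintegralZl//; last exact: inL1_ac.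
rewrite mulrCA -[X in X + _]mulr1 -mulrDr => EI.
have S0 : 0 < 1 + c * \int[mu]_(x in `[0, L]) zeta L (a + b * I) x.
  by rewrite ltr_pwDl// mulr_ge0// ltW.
rewrite -(pmulr_lge0 _ S0) EI; apply: ae_int_ge0.
  by apply: inL1_ext (inL1M acz Ip) => x _; exact: mulrC.
by apply: ae_mp p0 => x h xL; rewrite mulr_ge0 ?h ?z0.
Qed.

End contraction.

(** The chain is stated link by link, from [j + 1] to [j]; for [j + 1 = m] the left side has
    [q ^+ 0] and is the right side of the second inequality. *)
Theorem theorem4p1 (R : realType) (L a b c : R) (p : R -> R)
  (hL : 0 < L) (ha : 0 < a) (hb : 0 < b) (hc : 0 < c)
  (hp : inL1 L p)
  (hnorm : normL1 L p
           < 2 * a ^+ 2 * constM L a c ^+ 2 / (b * L ^+ 2 * constN L a c))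
  (phi : R -> R)
  (hphi_ball : in_ballL1 L (2 * normL1 L p) phi)
  (hphi_fix : eqL1 L (opA L a b c p phi) phi)
  (phis : nat -> R -> R)
  (hphi0 : in_ballL1 L (2 * normL1 L p) (phis 0%N))
  (hphis_L1 : forall m : nat, inL1 L (phis m))
  (hphis : forall m : nat, eqL1 L (phis m.+1) (opA L a b c p (phis m))) :
  let w := opS L a c phi in
  let ws := fun m : nat => opS L a c (phis m) in
  let q := constq L a b c p in
  let K := constK L a c in
  let dist := fun f g : R -> R => normL1 L (fun x => f x - g x) in
  [/\ q < 1,
      cvgL1 L ws w,
      forall m : nat,
        [/\ dist (ws m) w <= K * dist (phis m) phi,
            K * dist (phis m) phi <= K / (1 - q) * dist (phis m.+1) (phis m)
          & forall j : nat, (j < m)%N ->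
              q ^+ (m - j.+1) * K / (1 - q) * dist (phis j.+2) (phis j.+1)
              <= q ^+ (m - j) * K / (1 - q) * dist (phis j.+1) (phis j)]
    & {ae @lebesgue_measure R, forall x : R, x \in `[0, L] -> 0 <= p x} ->
        [/\ bvp_solution L a b c p w,
            0 <= \int[@lebesgue_measure R]_(t in `[0, L]) w t
          & forall u : R -> R, bvp_solution L a b c p u ->
              0 <= \int[@lebesgue_measure R]_(t in `[0, L]) u t ->
              forall x : R, x \in `[0, L] -> u x = w x]].
Proof.
move=> w ws q K dist.
have q1 : q < 1 by exact: constq_lt1 hnorm.
have q0 : 0 <= q by exact: constq_ge0.
have K0 : 0 <= K by exact: constK_ge0.
have [Iphi _] := hphi_ball.
have ball m : in_ballL1 L (2 * normL1 L p) (phis m).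
  elim: m => [//|m ih].
  by apply: (opA_ball _ _ _ _ _ _ ih _ (hphis m)) => //; exact: ltW.
have fix_phi : eqL1 L phi (opA L a b c p phi).
  by apply: ae_mp hphi_fix => x h /h.
have contr m : dist (phis m.+1) phi <= q * dist (phis m) phi.
  exact: opA_contraction (hphis m) fix_phi.
have contr2 m : dist (phis m.+2) (phis m.+1) <= q * dist (phis m.+1) (phis m).
  exact: opA_contraction (hphis m.+1) (hphis m).
have bnd m : dist (ws m) w <= K * dist (phis m) phi.
  have [v1 [v2 [v3 Hv]]] := opS_nonlocal hL ha hc (hphis_L1 m).
  have [w1 [w2 [w3 Hw]]] := opS_nonlocal hL ha hc Iphi.
  have := nonlocal_bound hL ha hc (nonlocal_lincomb (-1) Hv Hw).
  under [X in normL1 L X <= _ -> _]eq_fun do rewrite mulN1r.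
  by under [X in _ <= _ * normL1 L X -> _]eq_fun do rewrite mulN1r.
have geo m : dist (phis m) phi <= q ^+ m * dist (phis 0%N) phi.
  elim: m => [|m ih]; first by rewrite expr0 mul1r.
  by rewrite (le_trans (contr m))// exprS -mulrA ler_wpM2l.
split => //.
- have IS f : inL1 L f -> inL1 L (opS L a c f).
    by move=> If; have [? [? [? H]]] := opS_nonlocal hL ha hc If; have [] := beam_inL1s H.
  split; [by move=> m; exact: IS|exact: IS|].
  apply: (@squeeze_cvgr _ _ _ _ (fun=> 0) (fun m => K * dist (phis 0%N) phi * q ^+ m)).
  + apply: nearW => m; rewrite normL1_ge0 (le_trans (bnd m))//.
    by rewrite -mulrA ler_wpM2l// mulrC.
  + exact: cvg_cst.
  + rewrite -[X in _ --> X](mulr0 (K * dist (phis 0%N) phi)).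
    by apply: cvgM; [exact: cvg_cst|apply: cvg_expr; rewrite ger0_norm].
- move=> m; split => //.
  (* The triangle inequality through [phis m.+1] and the contraction give [(1 - q) dist (phis m) phi
     <= dist (phis m.+1) (phis m)]. *)
  + rewrite -mulrA ler_wpM2l// mulrC ler_pdivlMr ?subr_gt0//.
    have := normL1_triangle (hphis_L1 m) (hphis_L1 m.+1) Iphi.
    rewrite [X in _ <= X + _]normL1_distC.
    by have := contr m; rewrite /dist; lra.
  (* One factor [q] is split off the power to be absorbed by the contraction of consecutive
     iterates. *)
  + move=> j jm; rewrite -(subnSK jm) exprSr.
    have -> : q ^+ (m - j.+1) * q * K / (1 - q) * dist (phis j.+1) (phis j) =
      q ^+ (m - j.+1) * K / (1 - q) * (q * dist (phis j.+1) (phis j)) by ring.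
    apply: ler_wpM2l (contr2 j).
    by rewrite divr_ge0 ?subr_ge0 ?(ltW q1)// mulr_ge0 ?exprn_ge0.
- move=> p0.
  have Hw : bvp_solution L a b c p w by exact: fixed_point_bvp.
  have J0 : 0 <= \int[@lebesgue_measure R]_(t in `[0, L]) w t.
    exact: fixed_point_integral_ge0 q1 hphi_ball hphi_fix p0.
  by split => // u Hu I0 x xL; exact: bvp_unique p0 Hu Hw I0 J0 x xL.
Qed.
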